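(* Let $\mathcal{C}\subset\mathbb{P}^2$ be a rational plane curve of degree $d\geq 3$ over $\mathbb{C}$, with defining equation $F=0$, $F\in S=\mathbb{C}[x,y,z]$ homogeneous of degree $d$. Then $N(F)_k=0$ for all integers $k\leq d-3$, and $st(F)\leq 2d-3$.
   Context: A rational plane curve is a reduced irreducible curve in $\mathbb{P}^2=\mathbb{P}^2_{\mathbb{C}}$ whose normalization is $\mathbb{P}^1$ (equivalently, the image of a non-constant morphism $\mathbb{P}^1\to\mathbb{P}^2$). Let $S=\mathbb{C}[x,y,z]$ and let $F\in S$ be a homogeneous polynomial of degree $d$ such that $\mathcal{C}:F=0$ is reduced. Let $J=(F_x,F_y,F_z)\subset S$ be the Jacobian ideal generated by the partial derivatives of $F$, let $I$ be the saturation of $J$ with respect to the ideal $(x,y,z)$, and let $N(F)=I/J$, a graded $S$-module with degree $k$ component $N(F)_k$. Let $M(F)=S/J$ be the graded Milnor (Jacobian) algebra. The global Tjurina number $\tau(\mathcal{C})$ is $\dim_{\mathbb{C}} M(F)_q$ for large enough $q$ (equivalently the sum of the Tjurina numbers of the singular points of $\mathcal{C}$). The stability threshold is $st(F)=\min\{q : \dim_{\mathbb{C}} M(F)_k=\tau(\mathcal{C})\text{ for all }k\geq q\}$. *)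

(* Defs.v *)
From HB Require Import structures.
From mathcomp Require Import all_boot all_order all_algebra.
From mathcomp Require Import complex.
From mathcomp Require Import boolp reals.
From mathcomp Require Import mpoly.

Set Implicit Arguments.
Unset Strict Implicit.
Unset Printing Implicit Defensive.

Import GRing.Theory.
Local Open Scope ring_scope.

Definition irreducible_elt (A : idomainType) (a : A) : Prop :=
  [/\ a != 0, a \isn't a GRing.unit &
      forall b c : A, a = b * c -> b \is a GRing.unit \/ c \is a GRing.unit].

(* Points of P^(n-1) are represented by nonzero row vectors of length n. *)
Definition same_point (K : fieldType) (n : nat) (u v : 'rV[K]_n) : Prop :=
  exists2 c : K, c != 0 & u = c *: v.

Section PlaneCurve.

Variable K : fieldType.
Local Notation S := {mpoly K[3]}.

(* A morphism P^1 -> P^2 is a triple of binary forms of the same degree e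
   without common zero on P^1. *)
Definition is_morphism (e : nat) (phi : 'I_3 -> {mpoly K[2]}) : Prop :=
  (forall i, phi i \is e.-homog) /\
  (forall u : 'rV[K]_2, u != 0 -> exists i, (phi i).@[u 0] != 0).

Definition mor_val (phi : 'I_3 -> {mpoly K[2]}) (u : 'rV[K]_2) : 'rV[K]_3 :=
  \row_i (phi i).@[u 0].

Definition nonconstant (phi : 'I_3 -> {mpoly K[2]}) : Prop :=
  exists u v : 'rV[K]_2,
    [/\ u != 0, v != 0 & ~ same_point (mor_val phi u) (mor_val phi v)].

Definition image_is_zero_locus (phi : 'I_3 -> {mpoly K[2]}) (F : S) : Prop :=
  forall v : 'rV[K]_3, v != 0 ->
    (F.@[v 0] = 0 <->
     exists2 u : 'rV[K]_2, u != 0 & same_point v (mor_val phi u)).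

(* F = 0 is a reduced irreducible curve of degree d exactly when F is an
   irreducible form of degree d. *)
Definition rational_plane_curve (d : nat) (F : S) : Prop :=
  [/\ F \is d.-homog, irreducible_elt F &
      exists (e : nat) (phi : 'I_3 -> {mpoly K[2]}),
        [/\ is_morphism e phi, nonconstant phi & image_is_zero_locus phi F]].

Definition jacobian_ideal (F : S) (p : S) : Prop :=
  exists a : 'I_3 -> S, p = \sum_i a i * F^`M(i).

(* The union over n of the colon ideals (A : (x, y, z)^n); the ideal
   (x, y, z)^n is generated by the monomials of degree n. *)
Definition saturation (A : S -> Prop) (p : S) : Prop :=
  exists n : nat, forall m : 'X_{1..3}, mdeg m = n -> A ('X_[m] * p).

Definition in_degree (k : int) (p : S) : Prop :=
  if k is Posz n then p \is n.-homog else p = 0.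

(* N(F)_k = I_k / J_k is zero. *)
Definition N_vanishes (F : S) (k : int) : Prop :=
  forall p : S, in_degree k p ->
    saturation (jacobian_ideal F) p -> jacobian_ideal F p.

Lemma vspace_of_pred (V : vectType K) (P : V -> Prop) :
  P 0 -> (forall c u v, P u -> P v -> P (c *: u + v)) ->
  exists U : {vspace V}, forall v, v \in U <-> P v.
Proof.
move=> P0 Plin.
pose sub (U : {vspace V}) := forall v, v \in U -> P v.
pose Q n := `[< exists2 U, sub U & \dim U = n >].
have exQ : exists n, Q n.
  by exists 0%N; apply/asboolP; exists 0%VS; rewrite ?dimv0 // => v;
    rewrite memv0 => /eqP ->.
have leQ n : Q n -> (n <= \dim {:V})%N.
  by move=> /asboolP[U _ <-]; apply/dimvS/subvf.
case: (ex_maxnP exQ leQ) => n /asboolP[U subU dimU] maxn.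
exists U => v; split=> [|Pv]; first exact: subU.
have subUv : sub (U + <[v]>)%VS.
  move=> w /memv_addP[u uU [x /vlineP[c ->] ->]].
  by rewrite addrC; apply: Plin => //; apply: subU.
have /maxn : Q (\dim (U + <[v]>)) by apply/asboolP; exists (U + <[v]>)%VS.
rewrite -dimU => le_dim.
have /eqP -> : U == (U + <[v]>)%VS by rewrite eqEdim addvSl.
by apply: (subvP (addvSr U <[v]>)); apply: memv_line.
Qed.

Lemma jacobian_part_subproof (F : S) (k : nat) :
  exists U : {vspace dhomog 3 K k},
    forall p : dhomog 3 K k, p \in U <-> jacobian_ideal F (val p).
Proof.
apply: vspace_of_pred => [|c u v [a ua] [b vb]].
  by exists (fun=> 0); rewrite big1 //= => i _; rewrite mul0r.
exists (fun i => c *: a i + b i).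
rewrite linearP /= -[mpoly_of_dhomog u]/(val u) -[mpoly_of_dhomog v]/(val v).
rewrite ua vb scaler_sumr -big_split /=.
by apply: eq_bigr => i _; rewrite mulrDl scalerAl.
Qed.

(* The subspace J_k of S_k. *)
Definition jacobian_part (F : S) (k : nat) : {vspace dhomog 3 K k} :=
  sval (cid (jacobian_part_subproof F k)).

Lemma mem_jacobian_part (F : S) (k : nat) (p : dhomog 3 K k) :
  p \in jacobian_part F k <-> jacobian_ideal F (val p).
Proof. exact: (svalP (cid (jacobian_part_subproof F k))). Qed.

(* dim M(F)_k, with M(F)_k = S_k / J_k represented by a complement of J_k. *)
Definition milnor_dim (F : S) (k : nat) : nat := \dim (jacobian_part F k)^C.

Definition milnor_dim_from (F : S) (tau q : nat) : Prop :=
  forall k, (q <= k)%N -> milnor_dim F k = tau.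

Definition is_global_tjurina (F : S) (tau : nat) : Prop :=
  exists q0, milnor_dim_from F tau q0.

Definition is_stability_threshold (F : S) (s : nat) : Prop :=
  exists2 tau, is_global_tjurina F tau &
    milnor_dim_from F tau s /\ forall q, milnor_dim_from F tau q -> (s <= q)%N.

End PlaneCurve.

(* Main.v *)
Require Import Defs.
From HB Require Import structures.
From mathcomp Require Import all_boot all_order all_algebra.
From mathcomp Require Import complex.
From mathcomp Require Import boolp reals.
From mathcomp Require Import mpoly.
From mathcomp Require Import ring zify.

Set Implicit Arguments.
Unset Strict Implicit.
Unset Printing Implicit Defensive.

Import GRing.Theory Num.Theory VectorInternalTheory.
Local Open Scope ring_scope.

(** Let [S = K[x, y, z]], let [J] be the Jacobian ideal of [F] and [I] its
    saturation, let [phi] be a parametrisation of the curve by forms of degree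
    [m], and let [psi] be its restriction to an affine line of P^1.

    Low degrees. Euler's identity and the derivative of [F(psi) = 0] show that
    the gradient [F_a(psi)] is orthogonal to [psi] and to [psi'], hence
    proportional to the cross product [w = psi x psi'], which is nonzero because
    [phi] is not constant, and whose degree is at most [2m - 2] while that of the
    gradient is [m (d - 1)]. If [l ^ n p] is in [J], where [l] is a linear form
    that does not vanish at the zeros of [F_a(psi)], then [F_a(psi)] divides
    [l(psi) ^ n p(psi) w_a], hence [p(psi) w_a]. When [deg p <= d - 3] the degrees
    force [p(psi) = 0] ([saturation_bound]). In geometric terms, the elements of
    [I] are adjoint to the curve, and the canonical series of P^1 is empty. Now
    the forms that vanish along [psi] are the multiples of one form
    ([curve_ideal_principal], by Gauss's lemma), which is [F] up to a constant
    because [F] is irreducible. So [p = 0], and [I] is zero in degrees at most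
    [d - 3]: this is the first assertion, and the input of the second one.

    High degrees. Put [e = d - 1]. The second assertion says that multiplication
    by [l] from [(S / J)_q] to [(S / J)_(q + 1)] is bijective for
    [q >= 2 e - 1 = 2 d - 3]. The line [l = 0] can be taken to miss the common
    zeros of the partial derivatives; then two combinations [g] of these restrict
    to coprime binary forms of degree [e] on that line. It follows that
    [S / (g, l)] vanishes in degrees above [D = 2 e - 2], whence the surjectivity
    ([lin_surjective]), and that [l] is not a zero divisor modulo [(g)].

    Injectivity ([lin_injective]) is a duality argument. The residue of binary
    forms identifies [S / (g, l)] in degree [D] with [K] and makes it a Gorenstein
    ring; transporting it along powers of [l] gives a linear form [R] on
    [S_(2 q + 2)], and [(u, v) |-> R (u v)] is a symmetric bilinear form on
    [S_(q + 1)] with radical [(g)_(q + 1)]. A form [u] of any degree that is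
    orthogonal to all forms of degree [c] (multiplied by a power of [l]) agrees
    modulo [(g)] with a power of [l] times a form of degree less than [D - c]
    ([functional_perp]). Let [W = l J_q + (g)_(q + 1)]. If [u] is orthogonal to
    [W], then each [u F_a] is orthogonal to the forms of degree [q - e], hence is,
    modulo [(g)], a power of [l] times a form of degree at most [d - 3]; this form
    vanishes by the first part, so [u F_a] is in [(g)] and [u] is orthogonal to
    [J_(q + 1)]. Since [W] is its own double orthogonal, [J_(q + 1) = W], and
    cancelling [l] modulo [(g)] shows that [l p] in [J] implies [p] in [J]. *)

(** * Forms and their substitutions *)

Section Substitution.

Variables (n : nat) (R : comNzRingType).
Implicit Types (p q : {mpoly R[n]}) (k e : nat).

Lemma mpoly_ring_ind (P : {mpoly R[n]} -> Prop) :
  (forall c, P c%:MP) -> (forall i, P 'X_i) ->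
  (forall p q, P p -> P q -> P (p + q)) ->
  (forall p q, P p -> P q -> P (p * q)) -> forall p, P p.
Proof.
move=> PC PX PD PM; elim/mpolyind => [|c m p _ _ Pp]; first by rewrite -mpolyC0.
apply: PD => //; rewrite -mul_mpolyC; apply: (PM); first exact: PC.
have PM1 : P 1 by rewrite -mpolyC1.
rewrite mpolyXE_id; apply: (big_ind P PM1 PM) => i _.
by elim: (m i) => [|k IH]; rewrite ?expr0 // exprS; apply: PM.
Qed.

Lemma dhomog_ind k (P : {mpoly R[n]} -> Prop) :
  P 0 -> (forall c m, mdeg m = k -> P (c *: 'X_[m])) ->
  (forall p q, P p -> P q -> P (p + q)) -> forall p, p \is k.-homog -> P p.
Proof.
move=> P0 PX PD p /dhomogP homp; rewrite [p]mpolyE big_seq.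
by apply: (big_ind P P0 PD) => m /homp; apply: PX.
Qed.

Section Morphism.
Variables (A B : comNzRingType) (f : {rmorphism R -> A}).

Lemma mmap_dhomog_scale k (c : A) (h : 'I_n -> A) p : p \is k.-homog ->
  mmap f (fun i => c * h i) p = c ^+ k * mmap f h p.
Proof.
move: p; apply: dhomog_ind => [|a m <-|p q IHp IHq].
- by rewrite !mmap0 mulr0.
- rewrite !mmapZ !mmapX mulrCA; congr (_ * _); rewrite /mmap1.
  rewrite mdegE -prodrXr -big_split /=.
  by apply: eq_bigr => i _; rewrite exprMn.
- by rewrite !mmapD IHp IHq mulrDr.
Qed.

Lemma rmorph_mmap (g : {rmorphism A -> B}) (h : 'I_n -> A) p :
  g (mmap f h p) = mmap (g \o f) (g \o h) p.
Proof.
rewrite /mmap rmorph_sum; apply: eq_bigr => m _ /=.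
by rewrite rmorphM rmorph_prod; congr (_ * _); apply: eq_bigr => i _;
  rewrite rmorphXn.
Qed.

Lemma eq_mmap (f' : {rmorphism R -> A}) (h h' : 'I_n -> A) p :
  f =1 f' -> h =1 h' -> mmap f h p = mmap f' h' p.
Proof.
by move=> ef eh; rewrite /mmap; apply: eq_bigr => m _; rewrite ef (mmap1_eq _ eh).
Qed.

Lemma mmap_congr (l : A) (h h' : 'I_n -> A) p :
  (forall i, exists a, h i - h' i = l * a) ->
  exists a, mmap f h p - mmap f h' p = l * a.
Proof.
move=> hh'; elim/mpoly_ring_ind: p => [c|i|p q [a pa] [b qb]|p q [a pa] [b qb]].
- by exists 0; rewrite !mmapC subrr mulr0.
- by rewrite !mmapX !mmap1U.
- by exists (a + b); rewrite !mmapD mulrDr -pa -qb opprD addrACA.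
- exists (a * mmap f h q + mmap f h' p * b).
  rewrite !rmorphM mulrDr mulrA -pa mulrCA -qb.
  by rewrite mulrBl mulrBr addrA subrK.
Qed.

End Morphism.

Lemma mderiv_dhomog k i p : p \is k.+1.-homog -> p^`M(i) \is k.-homog.
Proof.
move: p; apply: dhomog_ind => [|c m degm|p q homp homq].
- by rewrite mderiv0 rpred0.
- rewrite mderivZ mderivX; apply/rpredZ.
  have [->|mi] := eqVneq (m i) 0%N; first by rewrite scale0r rpred0.
  apply/rpredZ; rewrite dhomogX; apply/eqP.
  have le_im : (U_(i) <= m)%MM.
    apply/mnm_lepP => j; rewrite mnm1E; case: eqP => // <-.
    by rewrite lt0n.
  have /(congr1 mdeg) : m = (m - U_(i) + U_(i))%MM by rewrite submK.
  by rewrite mdegD mdeg1 degm addn1 => -[].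
- by rewrite mderivD rpredD.
Qed.

Lemma euler_dhomog k p : p \is k.-homog ->
  \sum_i 'X_i * p^`M(i) = p *+ k.
Proof.
move: p; apply: dhomog_ind => [|c m <-|p q IHp IHq].
- by rewrite mul0rn big1 // => i _; rewrite mderiv0 mulr0.
- rewrite mdegE -sumrMnr; apply: eq_bigr => i _.
  rewrite mderivZ mderivX -scalerAr scalerMnr; congr (_ *: _).
  have [->|mi] := eqVneq (m i) 0%N; first by rewrite scale0r mulr0 mulr0n.
  rewrite -scalerAr -mpolyXD addmC submK ?scaler_nat //.
  apply/mnm_lepP => j; rewrite mnm1E; case: eqP => // <-.
  by rewrite lt0n.
- rewrite mulrnDl -IHp -IHq -big_split /=.
  by apply: eq_bigr => i _; rewrite mderivD mulrDr.
Qed.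

Lemma deriv_mmap (h : 'I_n -> {poly R}) p :
  (mmap (@polyC R) h p)^`() = \sum_i mmap (@polyC R) h p^`M(i) * (h i)^`().
Proof.
elim/mpoly_ring_ind: p => [c|j|p q IHp IHq|p q IHp IHq].
- rewrite mmapC derivC big1 // => i _.
  by rewrite mderivC mmap0 mul0r.
- rewrite mmapX mmap1U (bigD1 j) //= mderivX mnm1E eqxx scale1r.
  have -> : (U_(j) - U_(j) = 0 :> 'X_{1..n})%MM.
    by apply/mnmP => l; rewrite mnmBE mnm0E subnn.
  rewrite mmapX mmap11 mul1r big1 ?addr0 // => i ne_ij.
  by rewrite mderivX mnm1E eq_sym (negPf ne_ij) scale0r mmap0 mul0r.
- rewrite mmapD derivD IHp IHq -big_split /=.
  by apply: eq_bigr => i _; rewrite mderivD mmapD mulrDl.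
- rewrite rmorphM derivM IHp IHq mulr_suml mulr_sumr -big_split /=.
  apply: eq_bigr => i _; rewrite mderivM mmapD !rmorphM mulrDl.
  by rewrite mulrA mulrAC.
Qed.

Lemma horner_mmap (h : 'I_n -> {poly R}) p (t : R) :
  (mmap (@polyC R) h p).[t] = p.@[fun i => (h i).[t]].
Proof.
rewrite -[LHS]/(horner_eval t _) rmorph_mmap /meval.
by apply: eq_mmap => // c; rewrite /= /horner_eval hornerC.
Qed.

(** A binary form of degree [k], dehomogenised: [x] is then its value at the
    point at infinity. *)
Definition has_top k (x : R) (a : {poly R}) := (size a <= k.+1)%N /\ a`_k = x.

Lemma has_topM k l x y (a b : {poly R}) :
  has_top k x a -> has_top l y b -> has_top (k + l) (x * y) (a * b).
Proof.
move=> [sa <-] [sb <-]; split.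
  apply: leq_trans (size_polyMleq _ _) _.
  by rewrite -subn1 leq_subLR add1n -addSn -addnS leq_add.
rewrite coefM.
have lt_k : (k < (k + l).+1)%N by rewrite ltnS leq_addr.
rewrite (bigD1 (Ordinal lt_k)) //= addKn big1 ?addr0 // => i ne_ik.
have [lt_ik|le_ki] := ltnP i k.
  rewrite [b`__]nth_default ?mulr0 //; apply: leq_trans sb _; lia.
rewrite [a`__]nth_default ?mul0r //; apply: leq_trans sa _.
suff : (i != k :> nat) by lia.
by apply: contraNneq ne_ik => /eqP; rewrite -val_eqE.
Qed.

Lemma has_topD k x y (a b : {poly R}) :
  has_top k x a -> has_top k y b -> has_top k (x + y) (a + b).
Proof.
move=> [sa <-] [sb <-]; split; last by rewrite coefD.
by apply: leq_trans (size_polyD _ _) _; rewrite geq_max sa.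
Qed.

Lemma has_topX k m x (a : {poly R}) :
  has_top k x a -> has_top (k * m) (x ^+ m) (a ^+ m).
Proof.
move=> ha; elim: m => [|m IH]; last by rewrite mulnS !exprS; apply: has_topM.
by rewrite muln0 !expr0; split; rewrite ?size_poly1 // coefC.
Qed.

Lemma has_top_prod (I : finType) (k : I -> nat) (x : I -> R) (a : I -> {poly R}) :
  (forall i, has_top (k i) (x i) (a i)) ->
  has_top (\sum_i k i)%N (\prod_i x i) (\prod_i a i).
Proof.
move=> ha; elim/big_rec3: _ => [|i b y l _ IH]; last exact: has_topM.
by split; rewrite ?size_poly1 // coefC.
Qed.

Lemma has_top_mmap e k (x : 'I_n -> R) (h : 'I_n -> {poly R}) p :
  (forall i, has_top e (x i) (h i)) -> p \is k.-homog ->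
  has_top (e * k) p.@[x] (mmap (@polyC R) h p).
Proof.
move=> hh; move: p; apply: dhomog_ind => [|c m <-|p q IHp IHq].
- by rewrite meval0 mmap0; split; rewrite ?size_poly0 // coef0.
- rewrite mevalZ mmapZ mevalX mmapX -[(e * _)%N]add0n; apply: has_topM.
    by split; rewrite ?coefC // size_polyC_leq1.
  rewrite mdegE big_distrr /= /mmap1; apply: has_top_prod => i.
  exact: has_topX.
- by rewrite mevalD mmapD; apply: has_topD.
Qed.

Lemma pihomogMl e k p q : p \is e.-homog ->
  pihomog mdeg (e + k) (p * q) = p * pihomog mdeg k q.
Proof.
move=> homp; rewrite {1}(pihomog_partitionE (leqnn (msize q))).
rewrite mulr_sumr linear_sum /=.
have piM (j : nat) : pihomog mdeg (e + k) (p * pihomog mdeg j q) =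
    if j == k then p * pihomog mdeg j q else 0.
  have homj := dhomogM homp (pihomogP mdeg j q).
  case: eqP => [<-|ne_jk]; first exact: pihomog_dE.
  by apply: pihomog_ne0 homj; rewrite eqn_add2l; apply/eqP.
under eq_bigr => j _ do rewrite piM.
have [lt_k|le_k] := ltnP k (msize q).
  rewrite (bigD1 (Ordinal lt_k)) //= eqxx big1 ?addr0 // => j.
  by rewrite -val_eqE /= => /negPf ->.
rewrite big1 => [|j _]; last first.
  by have := ltn_ord j; case: eqP => // ->; rewrite ltnNge le_k.
rewrite /pihomog big_seq_cond big_pred0 ?mulr0 // => m.
apply/negP => /andP[/msize_mdeg_lt lt_m /eqP eq_m].
by move: lt_m; rewrite eq_m ltnNge le_k.
Qed.

Lemma pihomogMl_lt e k p q : (k < e)%N -> p \is e.-homog ->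
  pihomog mdeg k (p * q) = 0.
Proof.
move=> lt_ke homp; rewrite (pihomog_partitionE (leqnn (msize q))).
rewrite mulr_sumr linear_sum big1 // => j _.
by apply: pihomog_ne0 (dhomogM homp (pihomogP mdeg j q)); lia.
Qed.

(** The coefficients of a form [p] in an ideal generated by forms of degree [e]
    can be replaced by their homogeneous components of degree [k - e]; if [k < e]
    there are none, and [p] vanishes. *)
Lemma graded_combination (I : finType) e k (f : I -> {mpoly R[n]})
    (a : I -> {mpoly R[n]}) p :
  (forall i, f i \is e.-homog) -> p \is k.-homog -> p = \sum_i a i * f i ->
  p = 0 \/ exists2 l, k = (e + l)%N & exists2 b : I -> {mpoly R[n]},
    (forall i, b i \is l.-homog) & p = \sum_i b i * f i.
Proof.
move=> homf homp pE; have := pihomog_dE homp; rewrite {1}pE linear_sum /=.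
have [lt_ke|le_ek] := ltnP k e => pi_p.
  left; rewrite -pi_p big1 // => i _.
  by rewrite mulrC (pihomogMl_lt _ _ (homf i)).
right; exists (k - e)%N; rewrite ?subnKC //.
exists (fun i => pihomog mdeg (k - e) (a i)); first by move=> i; apply: pihomogP.
rewrite -{1}pi_p; apply: eq_bigr => i _.
by rewrite mulrC -{1}(subnKC le_ek) (pihomogMl _ _ (homf i)) mulrC.
Qed.

End Substitution.

(** * Dehomogenisation of ternary forms *)

Lemma mmap_id n (R : comNzRingType) (p : {mpoly R[n]}) :
  mmap (@mpolyC n R) (fun i => 'X_i) p = p.
Proof.
elim/mpoly_ring_ind: p => [c|i|p q IHp IHq|p q IHp IHq].
- by rewrite mmapC.
- by rewrite mmapX mmap1U.
- by rewrite mmapD IHp IHq.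
- by rewrite rmorphM /= IHp IHq.
Qed.

(** A polynomial killed by a substitution that fixes the variables modulo [l] is
    a multiple of [l]. This is how the kernels of the restrictions to a
    coordinate plane and to a line are computed. *)
Lemma ker_substitution n (R : comNzRingType) (l : {mpoly R[n]})
    (h : 'I_n -> {mpoly R[n]}) (p : {mpoly R[n]}) :
  (forall i, exists a, 'X_i - h i = l * a) ->
  exists a, p = mmap (@mpolyC n R) h p + l * a.
Proof.
move=> hl; have [a pE] := mmap_congr (@mpolyC n R) p hl.
by exists a; rewrite -pE mmap_id addrC subrK.
Qed.

Section Eval2.
Variables (K A : comNzRingType) (g : {rmorphism K -> A}) (a b : A).

Definition eval1 : {poly K} -> A := horner_morph (fun x => mulrC a (g x)).
HB.instance Definition _ := GRing.RMorphism.on eval1.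
Definition eval2 : {poly {poly K}} -> A :=
  horner_morph (fun c => mulrC b (eval1 c)).
HB.instance Definition _ := GRing.RMorphism.on eval2.

Lemma eval2C c : eval2 c%:P = eval1 c.
Proof. exact: horner_morphC. Qed.

Lemma eval2X : eval2 'X = b.
Proof. exact: horner_morphX. Qed.

Lemma eval1C c : eval1 c%:P = g c.
Proof. exact: horner_morphC. Qed.

Lemma eval1X : eval1 'X = a.
Proof. exact: horner_morphX. Qed.
End Eval2.

Section Dehomogenization.
Variables (K : fieldType) (i j k : 'I_3).
Hypotheses (ne_ij : j != i) (ne_ik : k != i) (ne_jk : k != j).
Local Notation S := {mpoly K[3]}.

Lemma third_index l : [|| l == i, l == j | l == k].
Proof.
by move: l i j k ne_ij ne_ik ne_jk => [[|[|[|?]]] ?] [[|[|[|?]]] ?]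
  [[|[|[|?]]] ?] [[|[|[|?]]] ?].
Qed.

(** Substituting [1], ['X] and the outer variable for the variables of indices
    [i], [j] and [k]. *)
Definition dehom : S -> {poly {poly K}} :=
  mmap (@polyC {poly K} \o @polyC K)
    (fun l => if l == i then 1 else if l == j then 'X%:P else 'X).
HB.instance Definition _ := GRing.RMorphism.on dehom.

(** Dehomogenisation corresponds to dividing the coordinates of [u] by [u i]. *)
Lemma eval2_dehom (A : fieldType) (g : {rmorphism K -> A}) (u : 'I_3 -> A) m p :
  u i != 0 -> p \is m.-homog ->
  eval2 g (u j / u i) (u k / u i) (dehom p) = (u i)^-1 ^+ m * mmap g u p.
Proof.
move=> ui homp; rewrite -(mmap_dhomog_scale _ _ _ homp) /dehom rmorph_mmap.
apply: eq_mmap => [c|l] /=; first by rewrite eval2C eval1C.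
have := third_index l.
have [->|_] /= := eqVneq l i; first by rewrite rmorph1 mulVf.
have [->|_] /= := eqVneq l j; first by rewrite eval2C eval1X mulrC.
by move/eqP->; rewrite eval2X mulrC.
Qed.

(** The quotients of the variables by ['X_i], in the fraction field of [S], give
    back [p / 'X_i ^+ m] from the dehomogenisation of [p]. *)
Lemma dehom_inj m p q : p \is m.-homog -> q \is m.-homog ->
  dehom p = dehom q -> p = q.
Proof.
move=> homp homq epq; apply/subr0_eq.
have homr : p - q \is m.-homog by rewrite rpredB.
have {epq} : dehom (p - q) = 0 by rewrite rmorphB /= epq subrr.
move: (p - q) homr => r homr dr.
pose u (l : 'I_3) : {fraction S} := FracField.tofrac 'X_l.
have ui : u i != 0 by rewrite tofrac_eq0 -msize_poly_eq0 msizeX.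
have := @eval2_dehom _ (@FracField.tofrac S \o @mpolyC 3 K) u _ _ ui homr.
rewrite dr rmorph0 => /esym/eqP; rewrite mulf_eq0 expf_eq0 invr_eq0.
rewrite (negPf ui) andbF /=.
have -> : mmap (@FracField.tofrac S \o @mpolyC 3 K) u r = FracField.tofrac r.
  by rewrite -{2}[r]mmap_id rmorph_mmap.
by rewrite tofrac_eq0 => /eqP.
Qed.

Lemma dehom_lift q : exists N, exists2 p, p \is N.-homog & dehom p = q.
Proof.
have Xhom (l : 'I_3) N : ('X_l : S) ^+ N \is N.-homog.
  by rewrite -[X in X.-homog]mul1n dhomogMn // dhomogX /= mdeg1.
have dX l : dehom 'X_l = if l == i then 1 else if l == j then 'X%:P else 'X.
  by rewrite /dehom mmapX mmap1U.
have dXi N : dehom ('X_i ^+ N) = 1 by rewrite rmorphXn /= dX eqxx expr1n.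
have step (l : 'I_3) N1 (p1 : S) N2 (p2 : S) :
    p1 \is N1.-homog -> p2 \is N2.-homog -> exists N, exists2 p, p \is N.-homog &
    dehom p = dehom p1 * dehom 'X_l + dehom p2.
  move=> hom1 hom2; exists (N1 + N2 + 1)%N.
  exists ('X_i ^+ N2 * p1 * 'X_l + 'X_i ^+ (N1 + 1) * p2).
    apply: rpredD; last by rewrite addnAC; apply: dhomogM.
    rewrite (addnC N1); apply: dhomogM; first exact: dhomogM.
    by rewrite dhomogX /= mdeg1.
  by rewrite rmorphD !rmorphM /= !dXi !mul1r.
elim/poly_ind: q => [|q c [N [p homp <-]]].
  by exists 0%N; exists 0; rewrite ?rmorph0 // rpred0.
have [N' [p' homp' <-]] : exists N, exists2 p, p \is N.-homog & dehom p = c%:P.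
  elim/poly_ind: c => [|c x [M [r homr er]]].
    by exists 0%N; exists 0; rewrite ?rmorph0 ?polyC0 // rpred0.
  have [|M' [r' homr' er']] := step j M r 0%N x%:MP homr.
    by rewrite -[x%:MP]mulr1 mul_mpolyC rpredZ // dhomog1.
  exists M'; exists r' => //; rewrite er' er dX (negPf ne_ij) eqxx.
  by rewrite /dehom mmapC /= polyCD polyCM.
have [M [r homr er]] := step k N p N' p' homp homp'.
exists M; exists r => //; rewrite er dX (negPf ne_ik) (negPf ne_jk).
by [].
Qed.

End Dehomogenization.

(** * The equation of a parametrised plane curve *)

Section KernelOfPoint.
Variables (K : closedFieldType) (L : fieldType) (g : {rmorphism K -> L}).
Variables (a b : L).
Hypothesis a_nonconst : forall r, a != g r.
Local Notation Q := {poly {poly K}}.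
Local Notation ev := (eval2 g a b).

Lemma eval1_neq0 c : c != 0 -> eval1 g a c != 0.
Proof.
move=> nzc; have [rs cE] := closed_field_poly_normal c; rewrite cE.
rewrite -mul_polyC rmorphM /= eval1C mulf_neq0 //.
  by rewrite fmorph_eq0 lead_coef_eq0.
rewrite rmorph_prod prodf_seq_neq0; apply/allP => r _ /=.
by rewrite rmorphB /= eval1X eval1C subr_eq0.
Qed.

Lemma dvd_of_eval0 (r : K) (p : Q) : map_poly (horner_eval r) p = 0 ->
  exists p', p = ('X - r%:P) *: p'.
Proof.
move=> p0; exists (map_poly (fun c => c %/ ('X - r%:P)) p).
apply/polyP => l; rewrite coefZ coef_map_id0 ?div0p // mulrC divpK //.
have /polyP/(_ l) := p0; rewrite coef_map coef0 /= => pl0.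
by rewrite dvdp_XsubCl; apply/rootP.
Qed.

(** This is Gauss's lemma. Over an algebraically closed field a nonconstant polynomial
    [c] in the first variable has a root [r], and setting the first variable to
    [r] in [c q = p G] shows that ['X - r] divides [p]. *)
Lemma gauss_cancel (G : Q) :
  (forall r, map_poly (horner_eval r) G != 0) ->
  forall c p q, c != 0 -> c *: q = p * G -> exists p', q = p' * G.
Proof.
move=> Gprim c; elim: {c}(size c) {-2}c (leqnn (size c)) => [|n IH] c.
  by rewrite size_poly_leq0 => /eqP-> p q; rewrite eqxx.
move=> szc p q nzc cq; have [le1|gt1] := leqP (size c) 1.
  move: nzc cq; rewrite (size1_polyC le1) polyC_eq0 => nzc cq.
  exists ((c`_0)^-1%:P *: p); rewrite -scalerAl -cq scalerA -polyCM.
  by rewrite mulVf // scale1r.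
have /closed_rootP[r /factor_theorem[c' cE]] : size c != 1 by rewrite gtn_eqF.
have nzX : 'X - r%:P != 0 by rewrite polyXsubC_eq0.
have nzc' : c' != 0 by apply: contraNneq nzc => c0; rewrite cE c0 mul0r.
have : map_poly (horner_eval r) p * map_poly (horner_eval r) G = 0.
  have c_r : horner_eval r c = 0.
    by rewrite /horner_eval cE hornerM hornerXsubC subrr mulr0.
  by rewrite -rmorphM -cq -mul_polyC rmorphM /= map_polyC /= c_r mul0r.
move=> /eqP; rewrite mulf_eq0 (negPf (Gprim r)) orbF => /eqP.
move=> /dvd_of_eval0[p' pE].
apply: (IH c' _ p') => //.
  by move: szc; rewrite cE size_Mmonic ?monicXsubC // size_XsubC addn2.
apply: (@mulfI _ ('X - r%:P)%:P); first by rewrite polyC_eq0.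
by rewrite !mul_polyC scalerA [_ * c']mulrC -cE cq pE scalerAl.
Qed.

(** The polynomials vanishing at the generic point [(a, b)] form a principal
    ideal: a generator is found by minimising the degree in the second variable,
    and then the degree of the leading coefficient, which makes it primitive. *)
Lemma kernel_principal (q0 : Q) : q0 != 0 -> ev q0 = 0 ->
  exists G, [/\ G != 0, ev G = 0 & forall q, ev q = 0 -> exists p, q = p * G].
Proof.
move=> nz0 ev0.
pose inK (q : Q) := q != 0 /\ ev q = 0.
have [n [q1 [[nz1 ev1] sz1]] minn] :
  exists2 n, exists q, inK q /\ size q = n &
    forall q, inK q -> (n <= size q)%N.
  have ex_n : exists n, `[< exists q, inK q /\ size q = n >].
    by exists (size q0); apply/asboolP; exists q0.
  case: (ex_minnP ex_n) => n /asboolP exq minn; exists n => // q inq.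
  by apply/minn/asboolP; exists q.
have ex_m : exists m, `[< exists q,
    [/\ inK q, size q = n & size (lead_coef q) = m] >].
  by exists (size (lead_coef q1)); apply/asboolP; exists q1.
case: (ex_minnP ex_m) => m /asboolP[G [[nzG evG] szG lcG]] minm.
exists G; split=> // q evq.
have Gprim r : map_poly (horner_eval r) G != 0.
  apply/negP => /eqP/dvd_of_eval0[G' GE].
  have nzX : 'X - r%:P != 0 by rewrite polyXsubC_eq0.
  have nzG' : G' != 0 by apply: contraNneq nzG => G0; rewrite GE G0 scaler0.
  have evG' : ev G' = 0.
    move: evG; rewrite GE -mul_polyC rmorphM /= eval2C => /eqP.
    by rewrite mulf_eq0 (negPf (eval1_neq0 nzX)) => /eqP.
  have szG' : size G' = n by rewrite -szG GE size_scale.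
  have /minm : `[< exists q, [/\ inK q, size q = n &
      size (lead_coef q) = size (lead_coef G')] >].
    by apply/asboolP; exists G'.
  rewrite -lcG GE lead_coefZ mulrC size_Mmonic ?lead_coef_eq0 ?monicXsubC //.
  by rewrite size_XsubC addn2 ltnn.
have /= qE := Pdiv.Idomain.divp_eq q G.
have r0 : q %% G = 0.
  apply/eqP/negPn/negP => nzr.
  have : (n <= size (q %% G)%R)%N.
    apply: minn; split=> //; move/(congr1 ev): qE.
    rewrite -mul_polyC rmorphM rmorphD rmorphM /= evq evG !mulr0 add0r.
    by move <-.
  by rewrite leqNgt -szG ltn_modp nzG.
rewrite r0 addr0 in qE; apply: gauss_cancel Gprim _ _ _ _ qE.
by rewrite expf_neq0 // lead_coef_eq0.
Qed.

End KernelOfPoint.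

Section CurveIdeal.
Variables (K : closedFieldType) (phi : 'I_3 -> {poly K}).
Local Notation S := {mpoly K[3]}.
Local Notation ev := (mmap (@polyC K) phi).

Lemma X_dvd (i : 'I_3) (p : S) :
  (exists q, p = 'X_i * q) <->
  mmap (@mpolyC 3 K) (fun l => if l == i then 0 else 'X_l) p = 0.
Proof.
split=> [[q ->]|p0].
  by rewrite rmorphM /= mmapX mmap1U eqxx mul0r.
have [l|q ->] := ker_substitution (l := 'X_i)
    (h := fun l => if l == i then 0 else 'X_l) p.
  have [->|_] := eqVneq l i; first by exists 1; rewrite subr0 mulr1.
  by exists 0; rewrite subrr mulr0.
by exists q; rewrite p0 add0r.
Qed.

Lemma X_prime (i : 'I_3) (p q : S) : (exists r, p * q = 'X_i * r) ->
  (exists r, p = 'X_i * r) \/ (exists r, q = 'X_i * r).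
Proof.
move/X_dvd; rewrite rmorphM /= => /eqP; rewrite mulf_eq0.
by case/orP => /eqP/X_dvd; [left | right].
Qed.

(** The same cancellation as in [gauss_cancel], for the variable that
    dehomogenisation sets to [1]. *)
Lemma X_cancel (i : 'I_3) (G : S) : ~ (exists r, G = 'X_i * r) ->
  forall s p q, 'X_i ^+ s * p = q * G -> exists q', p = q' * G.
Proof.
move=> XG; elim=> [|s IH] p q; first by rewrite expr0 mul1r; exists q.
rewrite exprS -mulrA => eq_pq.
have [] := @X_prime i q G; first by exists ('X_i ^+ s * p).
  case=> q' qE; apply: (IH p q'); apply: (@mulfI _ 'X_i).
    by rewrite -msize_poly_eq0 msizeX.
  by rewrite eq_pq qE mulrA.
by move/XG.
Qed.

(** The generator is the form of least degree that dehomogenises to a generator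
    of the kernel of evaluation at the generic point of the curve; being of
    least degree, it is prime to ['X_i], so that divisibility can be pulled back
    from the dehomogenised polynomials. *)
Lemma curve_ideal_principal (i j : 'I_3) (F : S) d :
  phi i != 0 -> (forall c, phi j != c *: phi i) ->
  F != 0 -> F \is d.-homog -> ev F = 0 ->
  exists2 G, ev G = 0 & forall m p, p \is m.-homog -> ev p = 0 ->
    exists q, p = q * G.
Proof.
move=> nzi nconst nzF homF evF.
have ne_ij : j != i.
  by apply: contraNneq (nconst 1) => ->; rewrite scale1r.
have [k ne_ik ne_jk] : exists2 k : 'I_3, k != i & k != j.
  have : (#|[set i; j]| < #|[set: 'I_3]|)%N.
    by rewrite cards2 cardsT card_ord; case: (_ != _).
  rewrite ltnNge => /negP; case: (set_0Vmem (~: [set i; j])) => [ij0|[k]].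
    by case; rewrite -[[set i; j]]setCK ij0 setC0.
  by rewrite !inE negb_or => /andP[]; exists k.
pose fr : {rmorphism _ -> _} := @FracField.tofrac {poly K}.
pose u l := fr (phi l).
have ui : u i != 0 by rewrite /u /fr tofrac_eq0.
pose g : {rmorphism K -> _} := fr \o @polyC K.
have aP r : u j / u i != g r.
  apply: contraNneq (nconst r) => /(canRL (divfK ui)) /eqP.
  by rewrite /u /g /= -rmorphM /= tofrac_eq mul_polyC.
pose ev2 : {rmorphism _ -> _} := eval2 g (u j / u i) (u k / u i).
pose deh : {rmorphism S -> _} := dehom i j.
have ev2E m p : p \is m.-homog -> ev2 (deh p) = (u i)^-1 ^+ m * fr (ev p).
  move=> homp; rewrite (rmorph_mmap (@polyC K) fr).
  exact: (eval2_dehom ne_ij ne_ik ne_jk g ui homp).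
have injd m p q := @dehom_inj K i j k ne_ij ne_ik ne_jk m p q.
have nzdF : deh F != 0.
  apply: contraNneq nzF => dF0; apply/eqP; apply: (injd d) => //; first exact: rpred0.
  by rewrite rmorph0.
have evdF : ev2 (deh F) = 0 by rewrite (ev2E _ _ homF) evF rmorph0 mulr0.
have [G0 [nzG0 evG0 G0P]] := kernel_principal aP nzdF evdF.
have ex_N : exists N, `[< exists2 p : S, p \is N.-homog & deh p = G0 >].
  by have [N liftG] := dehom_lift ne_ij ne_ik ne_jk G0; exists N; apply/asboolP.
case: (ex_minnP ex_N) => N /asboolP[G homG dG] minN.
have dXi s : deh ('X_i ^+ s) = 1.
  by rewrite rmorphXn /= /deh /dehom mmapX mmap1U eqxx expr1n.
have Xhom s : ('X_i : S) ^+ s \is s.-homog.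
  by rewrite -[X in X.-homog]mul1n dhomogMn // dhomogX /= mdeg1.
have XG : ~ exists r, G = 'X_i * r.
  case=> r GE; have := pihomog_dE homG; rewrite GE.
  have homX : ('X_i : S) \is 1.-homog := Xhom 1%N.
  case: N homG minN => [|N] homG minN.
    rewrite (pihomogMl_lt _ _ homX) // -GE => G00.
    by case/eqP: nzG0; rewrite -dG -G00 rmorph0.
  rewrite -(add1n N) (pihomogMl _ _ homX) -GE => GE'.
  have /minN : `[< exists2 p : S, p \is N.-homog & deh p = G0 >].
    apply/asboolP; exists (pihomog mdeg N r); first exact: pihomogP.
    by rewrite -dG -GE' rmorphM /= (dXi 1%N) mul1r.
  by rewrite ltnn.
exists G.
  have := ev2E _ _ homG; rewrite dG [LHS]evG0 => /esym/eqP.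
  rewrite mulf_eq0 expf_eq0 invr_eq0 (negPf ui) andbF /=.
  by rewrite tofrac_eq0 => /eqP.
move=> m p homp evp.
have [q0 dpE] : exists q, deh p = q * G0.
  by apply: G0P; rewrite (ev2E _ _ homp) evp rmorph0 mulr0.
have [M [q homq dq]] := dehom_lift ne_ij ne_ik ne_jk q0.
apply: (X_cancel XG (s := (M + N)%N) (q := 'X_i ^+ m * q)).
apply: (injd (m + (M + N))%N).
- by rewrite (addnC m); apply: dhomogM => //; apply: Xhom.
- by rewrite addnA; apply: dhomogM => //; apply: dhomogM => //; apply: Xhom.
- by rewrite !rmorphM /= !dXi !mul1r dq dG dpE.
Qed.

(** The generator is not a unit since it vanishes along [phi], so [F] is the
    generator up to a unit. *)
Lemma irreducible_dvd (i j : 'I_3) (F : S) d :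
  phi i != 0 -> (forall c, phi j != c *: phi i) ->
  irreducible_elt F -> F \is d.-homog -> ev F = 0 ->
  forall m p, p \is m.-homog -> ev p = 0 -> exists q, p = q * F.
Proof.
move=> nzi nconst [nzF _ irrF] homF evF m p homp evp.
have [G evG GP] := curve_ideal_principal nzi nconst nzF homF evF.
have [C FE] := GP _ _ homF evF; have [q ->] := GP _ _ homp evp.
case: (irrF _ _ FE) => [Cunit|Gunit].
  by exists (q * C^-1); rewrite FE mulrA divrK.
by have := rmorph_unit ev Gunit; rewrite /= evG unitr0.
Qed.

Lemma vanish_low_degree (i j : 'I_3) (F : S) d :
  phi i != 0 -> (forall c, phi j != c *: phi i) ->
  irreducible_elt F -> F \is d.-homog -> ev F = 0 ->
  forall m p, (m < d)%N -> p \is m.-homog -> ev p = 0 -> p = 0.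
Proof.
move=> nzi nconst irrF homF evF m p lt_md homp evp.
have [q pE] := irreducible_dvd nzi nconst irrF homF evF homp evp.
have := pihomog_dE homp.
by rewrite pE mulrC (pihomogMl_lt _ lt_md homF) => <-.
Qed.

End CurveIdeal.

(** * Duality of bilinear forms *)

Lemma kermx_factor (K : fieldType) m n p (A : 'M[K]_(m, n)) (B : 'M[K]_(m, p)) :
  kermx A *m B = 0 -> exists X, B = A *m X.
Proof.
move=> kerB; suff /submxP[D BE] : (B^T <= A^T)%MS.
  by exists D^T; rewrite -[B]trmxK BE trmx_mul trmxK.
rewrite submxE -[cokermx _]trmxK -trmx_mul.
have /submxP[D ->] : ((cokermx A^T)^T <= kermx A)%MS.
  by apply/sub_kermxP; rewrite -[A in X in _ *m X]trmxK -trmx_mul mulmx_coker trmx0.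
by rewrite -mulmxA kerB mulmx0 trmx0.
Qed.


(** In coordinates, let the rows of [N] span [W] and let [M] be the matrix of [b].
    The hypothesis on [y] says that [M *m y^T] is killed by every row vector that
    kills [M *m N^T], so it is a combination of the columns of [M *m N^T]; hence
    [y] differs from a vector of [W] by an element of the radical. *)
Lemma double_orthogonal (K : fieldType) (V : vectType K) (b : V -> V -> K)
    (W : V -> Prop) (y : V) :
  (forall u, linear_for *%R (b u)) -> (forall u v, b u v = b v u) ->
  W 0 -> (forall c u v, W u -> W v -> W (c *: u + v)) ->
  (forall u, (forall v, b u v = 0) -> W u) ->
  (forall u, (forall w, W w -> b u w = 0) -> b u y = 0) ->
  W y.
Proof.
move=> blin bsym W0 Wlin Wrad Wperp.
have [U UP] := vspace_of_pred W0 Wlin.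
have bZD u c v w : b u (c *: v + w) = c * b u v + b u w := blin u c v w.
have b0 u : b u 0 = 0.
  by have := bZD u (-1) 0 0; rewrite scaler0 addr0 mulN1r addNr.
have bZ u c v : b u (c *: v) = c * b u v by rewrite -[c *: v]addr0 bZD b0 addr0.
have bD u v w : b u (v + w) = b u v + b u w by rewrite -[v]scale1r bZD mul1r scale1r.
have bsum u n (F : 'I_n -> V) : b u (\sum_s F s) = \sum_s b u (F s).
  exact: (big_morph (b u) (bD u) (b0 u)).
pose n := dim V; pose B (s : 'I_n) : V := @r2v _ V (delta_mx 0 s : 'rV[K]_n).
pose M : 'M[K]_n := \matrix_(s, t) b (B s) (B t).
have r2vE (x : 'rV[K]_n) : @r2v _ V x = \sum_s x 0 s *: B s :> V.
  rewrite {1}[x]row_sum_delta linear_sum.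
  by apply: eq_bigr => s _; rewrite linearZ.
have bM (x z : 'rV[K]_n) : b (@r2v _ V x) (@r2v _ V z) = (x *m M *m z^T) 0 0.
  rewrite [@r2v _ V z]r2vE bsum !mxE; apply: eq_bigr => t _.
  rewrite bZ bsym r2vE bsum !mxE mulrC; congr (_ * _).
  by apply: eq_bigr => s _; rewrite bZ bsym !mxE.
pose N : 'M[K]_(\dim U, n) := \matrix_(s < \dim U) v2r (vbasis U)`_s.
have rowU s : row s N = v2r (vbasis U)`_s by rewrite rowK.
have NU s : @r2v _ V (row s N) \in U.
  by rewrite rowU v2rK vbasis_mem // mem_nth // size_tuple.
have combU (x : 'rV_(\dim U)) : @r2v _ V (x *m N) \in U.
  rewrite mulmx_sum_row linear_sum; apply: rpred_sum => s _.
  by rewrite linearZ; apply/rpredZ/NU.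
have Uspan w : w \in U -> exists x : 'rV_(\dim U), v2r w = x *m N.
  move=> /coord_vbasis ->; exists (\row_s coord (vbasis U) s w).
  rewrite linear_sum mulmx_sum_row; apply: eq_bigr => s _.
  by rewrite linearZ rowU mxE.
have [X yE] : exists X, M *m (v2r y)^T = M *m N^T *m X.
  apply: kermx_factor; apply/row_matrixP => s; rewrite row0.
  apply/rowP => t; rewrite ord1 [in RHS]mxE.
  rewrite row_mul mulmxA -bM v2rK; apply: Wperp => w /UP/Uspan[x wE].
  rewrite -[w]v2rK wE bM trmx_mul !mulmxA -[_ *m M *m _]mulmxA.
  by rewrite -row_mul mulmx_ker row0 mul0mx mxE.
suff : y \in U by move/UP.
have -> : y = @r2v _ V (v2r y - X^T *m N) + @r2v _ V (X^T *m N).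
  by rewrite -linearD subrK /= v2rK.
apply: rpredD => //; apply/UP/Wrad => v; rewrite bsym -[v]v2rK bM.
rewrite linearB /= trmx_mul trmxK -mulmxA mulmxBr yE mulmxA subrr.
by rewrite mulmx0 mxE.
Qed.

(** * Residues of binary forms *)

Section Residue.
Variables (K : fieldType) (e : nat) (g1 g2 c : {poly K}).
Hypotheses (sz1 : size g1 = e.+1) (sz2 : (size g2 <= e.+1)%N).
Hypothesis c_inv : g1 %| c * g2 - 1.

Let nz1 : g1 != 0.
Proof. by rewrite -size_poly_eq0 sz1. Qed.

(** The binary forms of degree [i] in the ideal [(g1, g2)]: the coefficients are
    forms of degree [i - e]. *)
Definition bin_in i (u : {poly K}) := exists a b : {poly K},
  [/\ (size a <= i.+1 - e)%N, (size b <= i.+1 - e)%N & u = a * g1 + b * g2].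

(** A polynomial [w] of formal degree [2e - 2] is [a * g1 + b * g2] with
    [b = (w * c) %% g1] of size at most [e]. As a binary form, [w] is in the ideal
    exactly when [b] has formal degree [e - 2], that is, when its coefficient of
    degree [e - 1] is zero. *)
Definition residue (w : {poly K}) : K := ((w * c) %% g1)`_e.-1.

Lemma residueD a u v : residue (a *: u + v) = a * residue u + residue v.
Proof. by rewrite /residue mulrDl -scalerAl modpD modpZl coefD coefZ. Qed.

Lemma residue_bin_in (a b : {poly K}) : (0 < e)%N -> (size b <= e.-1)%N ->
  residue (a * g1 + b * g2) = 0.
Proof.
move=> e_gt0 szb; rewrite /residue.
have -> : (a * g1 + b * g2) * c = (a * c) * g1 + b * (c * g2 - 1) + b by ring.
rewrite 2!modpD modp_mull (eqP (dvdp_mull b c_inv)) !add0r modp_small.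
  exact: nth_default.
by rewrite sz1 (leq_ltn_trans szb) // ltnS leq_pred.
Qed.

Lemma bin_in_small i (u : {poly K}) : (size u <= i.+1)%N ->
  (size ((u * c) %% g1)%R <= i.+1 - e)%N -> bin_in i u.
Proof.
set s := (u * c) %% g1 => szu szs.
have /dvdpP[a aE] : g1 %| u - s * g2.
  have -> : u - s * g2 = (u * c - s) * g2 - u * (c * g2 - 1) by ring.
  apply: dvdp_sub; last exact: dvdp_mull.
  apply: dvdp_mulr.
  by apply/modp_eq0P; rewrite modpD modpN modp_id subrr.
exists a, s; split=> //; last by rewrite -aE subrK.
have [->|nza] := eqVneq a 0; first by rewrite size_poly0.
have : (size (a * g1)%R <= i.+1)%N.
  rewrite -aE; apply: leq_trans (size_polyD _ _) _.
  rewrite size_polyN geq_max szu /=.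
  have [->|nzs] := eqVneq s 0; first by rewrite mul0r size_poly0.
  have sgt0 : (0 < size s)%N by rewrite size_poly_gt0.
  apply: leq_trans (size_polyMleq _ _) _.
  by move: (size s) szs sgt0 (size g2) sz2 => m le_m m_gt0 m' le_m'; lia.
by rewrite size_mul // sz1 addnS /=; move: (size a) => m; lia.
Qed.

Lemma bin_surjective i (u : {poly K}) : (e.*2.-1 <= i)%N ->
  (size u <= i.+1)%N -> bin_in i u.
Proof.
move=> le_ei szu; apply: bin_in_small => //.
have := ltn_modp (u * c) g1; rewrite nz1 sz1 ltnS => /leq_trans -> //; lia.
Qed.

(** If [s], the coefficient of [g2], were too large for [u] to be in the ideal,
    multiplying [u] by the power of ['X] that brings [s] to size [e] would give
    the leading coefficient of [s] as residue. *)
Lemma residue_nondegenerate i (u : {poly K}) : (i <= e.-1.*2)%N ->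
  (size u <= i.+1)%N ->
  (forall v : {poly K}, (size v <= (e.-1.*2 - i).+1)%N -> residue (u * v) = 0) ->
  bin_in i u.
Proof.
move=> le_i szu res0; apply: bin_in_small => //.
set s := (u * c) %% g1; have szs : (size s <= e)%N.
  by have := ltn_modp (u * c) g1; rewrite nz1 sz1.
have [->|nzs] := eqVneq s 0; first by rewrite size_poly0.
have sgt0 : (0 < size s)%N by rewrite size_poly_gt0.
rewrite leqNgt; apply/negP => lt_s.
have szX : (size ('X^(e - size s) * s)%R = e)%N.
  by rewrite size_monicM ?monicXn // size_polyXn addSn subnK.
suff : residue (u * 'X^(e - size s)) = lead_coef s.
  rewrite res0 => [/esym/eqP|]; first by rewrite lead_coef_eq0 (negPf nzs).
  by rewrite size_polyXn; lia.
have -> : residue (u * 'X^(e - size s)) = (('X^(e - size s) * s) %% g1)`_e.-1.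
  by rewrite /s modp_mul /residue; congr (_ %% _)`_ _; ring.
rewrite modp_small ?szX ?sz1 // coefXnM ifF; last by apply/negP; lia.
by rewrite /lead_coef; congr (_`_ _); lia.
Qed.
End Residue.

(** * Restriction of forms to a line *)

Lemma dhomog_mmap n (R : comNzRingType) k (h : 'I_n -> {mpoly R[n]}) p :
  (forall i, h i \is 1.-homog) -> p \is k.-homog ->
  mmap (@mpolyC n R) h p \is k.-homog.
Proof.
move=> homh; move: p; apply: dhomog_ind => [|c m <-|p q IHp IHq].
- by rewrite mmap0 rpred0.
- rewrite mmapZ mmapX mul_mpolyC rpredZ // mdegE /mmap1.
  elim/big_rec2: _ => [|i d p _ homp]; first exact: dhomog1.
  by apply: dhomogM => //; rewrite -[X in X.-homog]mul1n dhomogMn.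
- by rewrite mmapD rpredD.
Qed.

Section InIdeal.
Variables (S : comNzRingType) (I : finType) (f : I -> S).

Definition in_ideal (p : S) : Prop := exists a : I -> S, p = \sum_i a i * f i.

Lemma in_ideal0 : in_ideal 0.
Proof. by exists (fun=> 0); rewrite big1 // => i _; rewrite mul0r. Qed.

Lemma in_idealD p q : in_ideal p -> in_ideal q -> in_ideal (p + q).
Proof.
move=> [a ->] [b ->]; exists (fun i => a i + b i).
by rewrite -big_split /=; apply: eq_bigr => i _; rewrite mulrDl.
Qed.

Lemma in_idealM r p : in_ideal p -> in_ideal (r * p).
Proof.
move=> [a ->]; exists (fun i => r * a i); rewrite mulr_sumr.
by apply: eq_bigr => i _; rewrite mulrA.
Qed.

Lemma in_idealMr r p : in_ideal p -> in_ideal (p * r).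
Proof. by rewrite mulrC; apply: in_idealM. Qed.

Lemma in_idealN p : in_ideal p -> in_ideal (- p).
Proof. by rewrite -mulN1r; apply: in_idealM. Qed.

Lemma in_idealB p q : in_ideal p -> in_ideal q -> in_ideal (p - q).
Proof. by move=> ip iq; apply/in_idealD/in_idealN. Qed.

Lemma in_ideal_sum (J : finType) (p : J -> S) :
  (forall j, in_ideal (p j)) -> in_ideal (\sum_j p j).
Proof.
by move=> ip; apply: (big_ind in_ideal in_ideal0 in_idealD) => j _; apply: ip.
Qed.

Lemma in_ideal_gen i : in_ideal (f i).
Proof.
exists (fun j => (j == i)%:R); rewrite (bigD1 i) //= eqxx mul1r.
by rewrite big1 ?addr0 // => j /negPf ->; rewrite mul0r.
Qed.

End InIdeal.

Section LineSection.
Variables (K : fieldType) (i j k : 'I_3) (alpha beta : K).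
Hypotheses (ne_ij : j != i) (ne_ik : k != i) (ne_jk : k != j).
Local Notation S := {mpoly K[3]}.
Implicit Types (p q u v w : S).

(** A line that avoids the point where the variables of indices [i] and [j]
    vanish, and, in [res_line], the restriction of forms to it: the coordinate of
    the line is ['X], and its point at infinity is [(0 : 1 : beta)]. *)
Definition lin : S := 'X_k - (alpha *: 'X_i + beta *: 'X_j).

Definition res_line : S -> {poly K} :=
  mmap (@polyC K) (fun l => if l == i then 1 else if l == j then 'X
                            else alpha%:P + beta *: 'X).
HB.instance Definition _ := GRing.RMorphism.on res_line.

Lemma X_homog l : ('X_l : S) \is 1.-homog.
Proof. by rewrite dhomogX /= mdeg1. Qed.

Lemma lin_homog : lin \is 1.-homog.
Proof. by rewrite rpredB ?rpredD ?rpredZ ?X_homog. Qed.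

Lemma linX_homog n : lin ^+ n \is n.-homog.
Proof. by rewrite -[X in X.-homog]mul1n dhomogMn // lin_homog. Qed.

Lemma res_line_X l : res_line 'X_l =
  if l == i then 1 else if l == j then 'X else alpha%:P + beta *: 'X.
Proof. by rewrite /res_line mmapX mmap1U. Qed.

Lemma res_lineC c : res_line c%:MP = c%:P.
Proof. by rewrite /res_line mmapC. Qed.

Lemma res_lineZ c p : res_line (c *: p) = c *: res_line p.
Proof. by rewrite -mul_mpolyC rmorphM /= res_lineC mul_polyC. Qed.

Lemma lin_neq0 : lin != 0.
Proof.
apply/eqP => /(congr1 (mcoeff U_(k)%MM)) /eqP.
rewrite mcoeff0 mcoeffB mcoeffD !mcoeffZ !mcoeffXU eqxx.
rewrite (eq_sym i) (eq_sym j) (negPf ne_ik) (negPf ne_jk) !mulr0 addr0 subr0.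
by rewrite oner_eq0.
Qed.

Lemma res_line_top n p : p \is n.-homog ->
  has_top n p.@[fun l => if l == i then 0 else if l == j then 1 else beta]
    (res_line p).
Proof.
rewrite -[X in has_top X]mul1n; apply: has_top_mmap => l.
case: ifP => _; first by split; rewrite ?size_poly1 // coefC.
case: ifP => _; first by split; rewrite ?size_polyX // coefX.
split; last by rewrite coefD coefZ coefC coefX /= add0r mulr1.
apply: leq_trans (size_polyD _ _) _; rewrite geq_max.
rewrite (leq_trans (size_polyC_leq1 _)) //=.
by rewrite (leq_trans (size_scale_leq _ _)) // size_polyX.
Qed.

Lemma size_res_line n p : p \is n.-homog -> (size (res_line p) <= n.+1)%N.
Proof. by case/res_line_top. Qed.

(** Eliminating the variable of index [k] changes [p] by a multiple of [lin] and
    turns it into a form whose dehomogenisation is [res_line p]. *)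
Lemma ker_res_line n p : p \is n.-homog -> res_line p = 0 ->
  p = 0 \/ exists2 n', n = n'.+1 & exists2 q, q \is n'.-homog & p = lin * q.
Proof.
move=> homp p0.
pose h l : S := if l == k then alpha *: 'X_i + beta *: 'X_j else 'X_l.
have [l|a pE] := ker_substitution (l := lin) (h := h) p.
  rewrite /h; have [->|_] := eqVneq l k; first by exists 1; rewrite mulr1.
  by exists 0; rewrite subrr mulr0.
have hp0 : mmap (@mpolyC 3 K) h p = 0.
  apply: (dehom_inj ne_ij ne_ik ne_jk (m := n)); last first.
  - transitivity (res_line p)%:P; last by rewrite p0 polyC0 rmorph0.
    rewrite /dehom rmorph_mmap /res_line rmorph_mmap.
    apply: eq_mmap => [c|l] /=; first by rewrite mmapC.
    rewrite /h; have := third_index ne_ij ne_ik ne_jk l.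
    have [->|_] /= := eqVneq l i.
      by rewrite (eq_sym i) (negPf ne_ik) mmapX mmap1U eqxx.
    have [->|_] /= := eqVneq l j.
      by rewrite (eq_sym j) (negPf ne_jk) mmapX mmap1U (negPf ne_ij) eqxx.
    move=> ->; rewrite mmapD !mmapZ !mmapX !mmap1U eqxx (negPf ne_ij) eqxx /=.
    by rewrite mulr1 polyCD -mul_polyC polyCM.
  - exact: rpred0.
  - apply: dhomog_mmap homp => l; rewrite /h.
    by case: ifP => _; rewrite ?rpredD ?rpredZ ?X_homog.
have := pihomog_dE homp; rewrite {1}pE hp0 add0r.
case: n homp => [|n] homp /=.
  by rewrite (pihomogMl_lt _ _ lin_homog) // => <-; left.
rewrite -(add1n n) (pihomogMl _ _ lin_homog) => <-; right; exists n => //.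
by exists (pihomog mdeg n a) => //; apply: pihomogP.
Qed.

Lemma res_line_lift n (u : {poly K}) : (size u <= n.+1)%N ->
  exists2 p, p \is n.-homog & res_line p = u.
Proof.
move=> szu; exists (\sum_(t < n.+1) u`_t *: ('X_i ^+ (n - t) * 'X_j ^+ t)).
  apply: rpred_sum => t _; apply: rpredZ.
  have le_tn : (t <= n)%N by rewrite -ltnS.
  have Xn l m : ('X_l : S) ^+ m \is m.-homog.
    by rewrite -[X in X.-homog]mul1n dhomogMn // X_homog.
  by have := dhomogM (Xn i (n - t)%N) (Xn j t); rewrite subnK.
rewrite rmorph_sum /= -[RHS](coefK u) poly_def.
rewrite (big_ord_widen n.+1 (fun t => u`_t *: 'X^t)) // [RHS]big_mkcond /=.
apply: eq_bigr => t _.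
rewrite res_lineZ rmorphM !rmorphXn /= !res_line_X eqxx (negPf ne_ij) eqxx.
rewrite expr1n mul1r; case: ltnP => // le_ut.
by rewrite nth_default // scale0r.
Qed.

End LineSection.

(** * Duality for a complete intersection of two curves of the same degree *)

Section Duality.
Variables (K : fieldType) (i j k : 'I_3) (alpha beta : K).
Hypotheses (ne_ij : j != i) (ne_ik : k != i) (ne_jk : k != j).
Local Notation S := {mpoly K[3]}.
Implicit Types (p q u v w : S).
Local Notation l := (lin i j k alpha beta).
Local Notation rho := (res_line i j alpha beta).

Variables (e : nat) (f : 'I_3 -> S) (g : bool -> S) (c : {poly K}).
Hypothesis e_gt0 : (0 < e)%N.
Hypothesis f_homog : forall a, f a \is e.-homog.
Hypothesis g_homog : forall b, g b \is e.-homog.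
Hypothesis g_in_f : forall b, in_ideal f (g b).
Hypothesis size_g1 : size (rho (g true)) = e.+1.
Hypothesis c_inv : rho (g true) %| c * rho (g false) - 1.
(** For the partial derivatives of [F] this is what the parametrisation gives, in
    [saturation_bound]. *)
Hypothesis saturation_low : forall n r p, (r.+2 <= e)%N -> p \is r.-homog ->
  in_ideal f (l ^+ n * p) -> p = 0.

Local Notation bin := (bin_in e (rho (g true)) (rho (g false))).
Local Notation res := (residue e (rho (g true)) c).
Local Notation D := (e.-1.*2).
Local Notation inf := (in_ideal f).
Local Notation ing := (in_ideal g).

Let size_g2 : (size (rho (g false)) <= e.+1)%N.
Proof. exact: size_res_line. Qed.

Let l_homog : l \is 1.-homog. Proof. exact: lin_homog. Qed.
Let lX_homog n : l ^+ n \is n.-homog. Proof. exact: linX_homog. Qed.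

Lemma ing_inf p : ing p -> inf p.
Proof. by move=> [a ->]; apply: in_ideal_sum => b; apply/in_idealM/g_in_f. Qed.

Lemma ing2 a b : ing (a * g true + b * g false).
Proof. by apply: in_idealD; apply/in_idealM/in_ideal_gen. Qed.

(** Membership in the ideal can be lifted from the line to the plane, at the cost
    of a multiple of [l]. *)
Lemma bin_in_lift n u : u \is n.-homog -> bin n (rho u) ->
  ing u \/ exists2 m, n = m.+1 & exists2 q, q \is m.-homog & ing (u - l * q).
Proof.
move=> homu [a [b [sza szb uE]]].
have [A [B [homAB AE BE]]] : exists A B, [/\ A * g true + B * g false \is n.-homog,
    rho A = a & rho B = b].
  have [lt_ne|le_en] := ltnP n e.
    have e0 : (n.+1 - e = 0)%N by apply/eqP; rewrite subn_eq0.
    exists 0, 0; rewrite !mul0r addr0 rmorph0; split; first exact: rpred0.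
      by apply/esym/eqP; rewrite -size_poly_leq0 -e0.
    by apply/esym/eqP; rewrite -size_poly_leq0 -e0.
  move: sza szb; rewrite subSn // => sza szb.
  have [A homA AE] := res_line_lift alpha beta ne_ij sza.
  have [B homB BE] := res_line_lift alpha beta ne_ij szb.
  exists A, B; split=> //; rewrite -(subnK le_en).
  by apply: rpredD; apply: dhomogM.
have homd : u - (A * g true + B * g false) \is n.-homog by rewrite rpredB.
have rd : rho (u - (A * g true + B * g false)) = 0.
  by rewrite rmorphB rmorphD !rmorphM /= AE BE uE subrr.
have [u0|[m -> [q homq uq]]] := ker_res_line ne_ij ne_ik ne_jk homd rd.
  by left; rewrite (subr0_eq u0); apply: ing2.
right; exists m => //; exists q => //.
by rewrite -uq opprB addrC subrK; apply: ing2.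
Qed.

(** The form [l] is not a zero divisor modulo [(g)]: a relation between the
    restrictions of the coprime forms [g] to the line is a multiple of the
    trivial one. *)
Lemma ing_cancel m w : w \is m.-homog -> ing (l * w) -> ing w.
Proof.
move=> homw [a lwE].
have hom_lw : l * w \is (1 + m).-homog by apply: dhomogM.
have nzl : l != 0 by apply: lin_neq0.
have [/eqP|[n nE [b homb]]] := graded_combination g_homog hom_lw lwE.
  by rewrite mulf_eq0 (negPf nzl) => /eqP->; apply: in_ideal0.
rewrite big_bool /= => {}lwE.
have r0 : rho (b true) * rho (g true) + rho (b false) * rho (g false) = 0.
  rewrite -!rmorphM -rmorphD -lwE /= rmorphM /= (_ : rho l = 0) ?mul0r //.
  rewrite rmorphB rmorphD /= !res_lineZ !res_line_X eqxx (negPf ne_ik).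
  by rewrite (negPf ne_jk) (negPf ne_ij) eqxx alg_polyC subrr.
have nzg1 : rho (g true) != 0 by rewrite -size_poly_eq0 size_g1.
have /dvdpP[t tE] : rho (g true) %| rho (b false).
  have -> : rho (b false) = - (rho (b false) * (c * rho (g false) - 1))
      + c * (rho (b true) * rho (g true) + rho (b false) * rho (g false))
      - c * rho (b true) * rho (g true) by ring.
  rewrite r0 mulr0 addr0; apply: dvdp_sub; last exact: dvdp_mull.
  by rewrite dvdpNr dvdp_mull.
have tE' : rho (b true) = - t * rho (g false).
  apply: (mulIf nzg1); apply/eqP; rewrite -subr_eq0 -r0 tE; apply/eqP; ring.
have [T [homT1 homT2 TE]] : exists T, [/\ T * g true \is n.-homog,
    T * g false \is n.-homog & rho T = t].
  have [->|nzt] := eqVneq t 0.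
    by exists 0; rewrite !mul0r rmorph0 !rpred0.
  have := size_res_line i j alpha beta (homb false).
  rewrite tE size_mul // size_g1 addnS /= => szt.
  have t_gt0 : (0 < size t)%N by rewrite size_poly_gt0.
  have le_en : (e <= n)%N by move: (size t) szt t_gt0 => x; clear; lia.
  have [|T homT TE] := res_line_lift alpha beta ne_ij (n := n - e) (u := t).
    by move: (size t) szt le_en => x; clear; lia.
  by exists T; rewrite -(subnK le_en) !dhomogM.
have k1 : rho (b true + T * g false) = 0.
  by rewrite rmorphD rmorphM /= TE tE' mulNr addNr.
have k2 : rho (b false - T * g true) = 0.
  by rewrite rmorphB rmorphM /= TE tE subrr.
have lq p : p \is n.-homog -> rho p = 0 -> exists q, p = l * q.
  move=> homp /(ker_res_line ne_ij ne_ik ne_jk homp) [->|[n' _ [q _ ->]]].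
    by exists 0; rewrite mulr0.
  by exists q.
have [|q1 q1E] := lq _ _ k1; first exact: rpredD (homb _) homT2.
have [|q2 q2E] := lq _ _ k2; first exact: rpredB (homb _) homT1.
suff -> : w = q1 * g true + q2 * g false by apply: ing2.
apply: (mulfI nzl); rewrite lwE mulrDr !mulrA -q1E -q2E; ring.
Qed.

Lemma ing_cancelX n m w : w \is m.-homog -> ing (l ^+ n * w) -> ing w.
Proof.
elim: n => [|n IH] homw; first by rewrite mul1r.
rewrite exprS -mulrA => /(ing_cancel (dhomogM (lX_homog n) homw)).
exact: IH.
Qed.

Lemma residue_ing w : w \is D.-homog -> ing w -> res (rho w) = 0.
Proof.
move=> homw [a wE].
have [->|[n nE [b homb ->]]] := graded_combination g_homog homw wE.
  by rewrite rmorph0 /residue mul0r mod0p coef0.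
rewrite big_bool /= rmorphD !rmorphM /= (residue_bin_in size_g1 c_inv) //.
by apply: leq_trans (size_res_line i j alpha beta (homb false)) _; lia.
Qed.

(** Multiplication by [l ^+ n] is onto from degree [D] to degree [D + n] modulo
    [(g)], because binary forms of degree more than [D] are in [(g)]. *)
Lemma residue_rep n p : p \is (D + n).-homog ->
  exists2 w, w \is D.-homog & ing (p - l ^+ n * w).
Proof.
elim: n p => [|n IH] p homp.
  exists p; first by rewrite addn0 in homp.
  by rewrite mul1r subrr; apply: in_ideal0.
have [|ip|[m mE [q homq iq]]] := bin_in_lift homp.
- by apply: (bin_surjective size_g1 size_g2 c_inv); [lia | apply: size_res_line].
- by exists 0; rewrite ?rpred0 // mulr0 subr0.
have [|w homw iw] := IH q; first by move: mE; rewrite addnS => -[->].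
exists w => //; have -> : p - l ^+ n.+1 * w = (p - l * q) + l * (q - l ^+ n * w).
  by rewrite exprS; ring.
by apply: in_idealD => //; apply: in_idealM.
Qed.

(** The residue, transported along the isomorphism that multiplication by
    [l ^+ n] induces between the pieces of [S / (g)] of degrees [D] and
    [D + n]. *)
Lemma residue_functional n : exists R : S -> K,
  [/\ forall a p q, p \is (D + n).-homog -> q \is (D + n).-homog ->
        R (a *: p + q) = a * R p + R q,
      forall p, p \is (D + n).-homog -> ing p -> R p = 0 &
      forall w, w \is D.-homog -> R (l ^+ n * w) = res (rho w)].
Proof.
have /choice[rep repP] : forall p, exists w, p \is (D + n).-homog ->
    w \is D.-homog /\ ing (p - l ^+ n * w).
  move=> p; have [homp|nhom] := boolP (p \is (D + n).-homog).
    by have [w homw iw] := residue_rep homp; exists w.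
  by exists 0 => homp; case/negP: nhom.
have uniq w w' : w \is D.-homog -> w' \is D.-homog ->
    ing (l ^+ n * w - l ^+ n * w') -> res (rho w) = res (rho w').
  move=> homw homw'; rewrite -mulrBr.
  have homd : w - w' \is D.-homog by rewrite rpredB.
  move=> /(ing_cancelX homd)/(residue_ing homd).
  rewrite rmorphB /= -scaleN1r addrC residueD mulN1r => /eqP.
  by rewrite addrC subr_eq0 => /eqP.
exists (fun p => res (rho (rep p))); split=> [a p q homp homq|p homp ip|w homw].
- have [homwp iwp] := repP _ homp; have [homwq iwq] := repP _ homq.
  have [|homr ir] := repP (a *: p + q); first by rewrite rpredD // rpredZ.
  rewrite -residueD -res_lineZ -rmorphD; apply: uniq => //=.
    by rewrite rpredD // rpredZ.
  rewrite (_ : _ - _ = a%:MP * (p - l ^+ n * rep p) + (q - l ^+ n * rep q) -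
      (a *: p + q - l ^+ n * rep (a *: p + q))).
    by apply: in_idealB => //; apply: in_idealD => //; apply: in_idealM.
  by rewrite -!mul_mpolyC; ring.
- have [homw iw] := repP _ homp; apply: residue_ing => //.
  apply: (ing_cancelX (n := n) homw).
  rewrite -[_ * _](subKr p); exact: in_idealB.
- have [|homw' iw] := repP (l ^+ n * w).
    by rewrite addnC; apply: dhomogM.
  by apply: uniq => //; rewrite -opprB; apply: in_idealN.
Qed.

Section Functional.
Variables (n : nat) (R : S -> K).
Hypothesis R_linear : forall a p q, p \is (D + n).-homog ->
  q \is (D + n).-homog -> R (a *: p + q) = a * R p + R q.
Hypothesis R_ing : forall p, p \is (D + n).-homog -> ing p -> R p = 0.
Hypothesis R_res : forall w, w \is D.-homog -> R (l ^+ n * w) = res (rho w).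

(** For [m <= D] the forms [v] on the line have degree [D - m] only, and a power
    of [l] completes them to degree [m']. *)
Lemma functional_bin m m' t u : (D <= m + m')%N ->
  (m + m' + t = D + n)%N -> u \is m.-homog ->
  (forall v, v \is m'.-homog -> R (l ^+ t * (u * v)) = 0) -> bin m (rho u).
Proof.
move=> le_D sumN homu perp.
have szu := size_res_line i j alpha beta homu.
have [lt_Dm|le_mD] := ltnP D m.
  by apply: (bin_surjective size_g1 size_g2 c_inv) => //; lia.
apply: (residue_nondegenerate size_g1 size_g2 c_inv) => // v szv.
have [V homV <-] := res_line_lift alpha beta ne_ij szv.
rewrite -rmorphM /= -R_res; last by rewrite -[D](subnKC le_mD) dhomogM.
have nE : n = (t + (m' - (D - m)))%N by clear -le_D sumN le_mD; lia.
have -> : l ^+ n * (u * V) = l ^+ t * (u * (l ^+ (m' - (D - m)) * V)).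
  by rewrite nE exprD; ring.
apply: perp.
have -> : m' = ((m' - (D - m)) + (D - m))%N by clear -le_D le_mD; lia.
by rewrite addnK; apply: dhomogM.
Qed.

(** As long as [m + m' >= D], a form that is orthogonal to degree [m'] is
    divisible by [l] modulo [(g)], and the quotient inherits the hypothesis with
    one more power of [l]; the descent stops below degree [D - m']. *)
Lemma functional_perp m m' t u : (m + m' + t = D + n)%N -> u \is m.-homog ->
  (forall v, v \is m'.-homog -> R (l ^+ t * (u * v)) = 0) ->
  exists s p, ing (u - l ^+ s * p) /\
    (p = 0 \/ exists2 r, (r + m' < D)%N & p \is r.-homog).
Proof.
elim: m t u => [|m IH] t u sumN homu perp.
  have [lt_D|le_D] := ltnP (0 + m') D.
    exists 0%N, u; rewrite mul1r subrr; split; first exact: in_ideal0.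
    by right; exists 0%N.
  have [iu|[? //]] := bin_in_lift homu (functional_bin le_D sumN homu perp).
  by exists 0%N, 0; rewrite mulr0 subr0; split; last by left.
have [lt_D|le_D] := ltnP (m.+1 + m') D.
  exists 0%N, u; rewrite mul1r subrr; split; first exact: in_ideal0.
  by right; exists m.+1.
have [iu|[_ [<-] [q homq iq]]] := bin_in_lift homu (functional_bin le_D sumN homu perp).
  by exists 0%N, 0; rewrite mulr0 subr0; split; last by left.
have [||v homv|s [p [ip pP]]] := IH t.+1 q => //; first by rewrite addnS -sumN.
  have homd : l ^+ t * ((u - l * q) * v) \is (D + n).-homog.
    rewrite -sumN addnC; apply: dhomogM => //; apply: dhomogM => //.
    by rewrite rpredB // -(add1n m) dhomogM.
  have homuv : l ^+ t * (u * v) \is (D + n).-homog.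
    by rewrite -sumN addnC; do 2!apply: dhomogM => //.
  have -> : l ^+ t.+1 * (q * v) =
      (-1) *: (l ^+ t * ((u - l * q) * v)) + l ^+ t * (u * v).
    by rewrite scaleN1r exprS; ring.
  rewrite R_linear // perp // addr0 R_ing ?mulr0 //.
  by apply/in_idealM/in_idealMr.
exists s.+1, p; split=> //.
have -> : u - l ^+ s.+1 * p = (u - l * q) + l * (q - l ^+ s * p).
  by rewrite exprS; ring.
by apply: in_idealD => //; apply: in_idealM.
Qed.

End Functional.

Lemma lin_surjective m p : (e.*2.-1 <= m.+1)%N -> p \is m.+1.-homog ->
  exists2 q, q \is m.-homog & inf (p - l * q).
Proof.
move=> le_m homp; have [|ip|[_ [<-] [q homq iq]]] := bin_in_lift homp.
- by apply: (bin_surjective size_g1 size_g2 c_inv) => //; apply: size_res_line.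
- by exists 0; [apply: rpred0 | rewrite mulr0 subr0; apply: ing_inf].
- by exists q => //; apply: ing_inf.
Qed.

(** The double orthogonal argument: [W] below is [l (f)_m + (g)] in degree
    [m + 1], and [u] orthogonal to [W] is orthogonal to all of [(f)]. *)
Lemma lin_injective m p : (e.*2.-1 <= m)%N -> p \is m.-homog ->
  inf (l * p) -> inf p.
Proof.
move=> le_m homp ilp; pose M := m.+1.
have [n nE] : exists n, (M + M = D + n)%N by exists (M + M - D)%N; clear -le_m; lia.
have [R [Rlin R0 Rres]] := residue_functional n.
have homlp : l * p \is M.-homog by rewrite /M -(add1n m) dhomogM.
have homM u v : u \is M.-homog -> v \is M.-homog -> u * v \is (D + n).-homog.
  by rewrite -nE; apply: dhomogM.
pose V := dhomog 3 K M.
pose b (u v : V) := R (val u * val v).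
pose W (u : V) := exists q, [/\ q \is m.-homog, inf q & ing (val u - l * q)].
suff [q [homq iq]] : W (DHomog homlp).
  rewrite /= -mulrBr => /ing_cancel => /(_ m); rewrite rpredB // => /(_ isT).
  by move=> /ing_inf ipq; rewrite -[p](subrK q); apply: in_idealD.
apply: (@double_orthogonal _ _ b).
- move=> u a v w; rewrite /b /= mulrDr -scalerAr.
  by rewrite Rlin // homM // dhomog_is_dhomog.
- by move=> u v; rewrite /b mulrC.
- exists 0; rewrite rpred0 mulr0 subr0; split=> //; exact: in_ideal0.
- move=> a u v [q [homq iq iu]] [r [homr ir iv]]; exists (a *: q + r).
  split; first by rewrite rpredD // rpredZ.
    by rewrite -mul_mpolyC; apply: in_idealD => //; apply: in_idealM.
  rewrite (_ : _ - _ = a%:MP * (val u - l * q) + (val v - l * r)).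
    by apply: in_idealD => //; apply: in_idealM.
  by rewrite /= -!mul_mpolyC; ring.
- move=> u perp; exists 0; rewrite rpred0 mulr0 subr0; split=> //.
    exact: in_ideal0.
  have [|||s [q [iq qP]]] := functional_perp Rlin R0 Rres (m := M) (m' := M)
      (t := 0) (u := val u).
  + by rewrite addn0.
  + exact: dhomog_is_dhomog.
  + by move=> v homv; rewrite mul1r; have := perp (DHomog homv).
  case: qP => [q0|[r]]; first by move: iq; rewrite q0 mulr0 subr0.
  by move=> lt_r _; clear -lt_r le_m; lia.
move=> u perpW; apply: (R0); first by apply: homM; apply: dhomog_is_dhomog.
have homu : val u \is M.-homog := dhomog_is_dhomog u.
have [a lpE] := ilp.
have [lp0|[h hE [a' homa' lpE']]] := graded_combination f_homog homlp lpE.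
  by rewrite /= lp0 mulr0; apply: in_ideal0.
rewrite /= lpE' mulr_sumr; apply: in_ideal_sum => x.
rewrite mulrCA; apply: in_idealM.
have le_eh : (e <= h)%N by clear -hE le_m; lia.
(* [u * f x] is orthogonal to the forms [v] of degree [h - 1], because
   [l * (f x * v)] is in [W]. *)
have [|||s [q [iq qP]]] := functional_perp Rlin R0 Rres (m := M + e)
    (m' := h.-1) (t := 1) (u := val u * f x).
- by rewrite -nE; clear -hE le_m le_eh e_gt0; lia.
- exact: dhomogM.
- move=> v homv; rewrite (_ : _ * _ = val u * (l * (f x * v))); last by ring.
  have homfv : f x * v \is m.-homog.
    by rewrite (_ : m = e + h.-1)%N ?dhomogM //; clear -hE le_eh e_gt0; lia.
  have homlfv : l * (f x * v) \is M.-homog by rewrite /M -(add1n m) dhomogM.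
  apply: (perpW (DHomog homlfv)); exists (f x * v); split=> //.
    exact/in_idealMr/in_ideal_gen.
  by rewrite /= subrr; apply: in_ideal0.
suff q0 : q = 0 by move: iq; rewrite q0 mulr0 subr0.
case: qP => // -[r lt_r homq].
apply: (saturation_low (n := s) _ homq); first by clear -lt_r le_eh e_gt0; lia.
rewrite -[_ * q](subKr (val u * f x)); apply: in_idealB; last exact: ing_inf.
exact/in_idealM/in_ideal_gen.
Qed.

End Duality.

(** * Polynomials over an algebraically closed field of characteristic zero *)

Section Field.
Variable K : numClosedFieldType.
Implicit Types (p q f h : {poly K}).

Lemma poly_nonroot p : p != 0 -> exists t, p.[t] != 0.
Proof.
move=> nzp; pose rs : seq K := [seq n%:R | n <- iota 0 (size p)].
have : ~~ all (root p) rs.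
  apply/negP => all_rs; have := max_poly_roots nzp all_rs.
  rewrite size_map size_iota ltnn map_inj_uniq ?iota_uniq; first by move/(_ isT).
  by move=> a b /eqP; rewrite eqr_nat => /eqP.
by rewrite -has_predC => /hasP[t _]; rewrite /= rootE; exists t.
Qed.

Lemma poly_eq0_values p : (forall t, p.[t] = 0) -> p = 0.
Proof.
move=> p0; apply/eqP/negPn/negP => /poly_nonroot[t].
by rewrite p0 eqxx.
Qed.

(** Each of the finitely many planes meets the curve [(1, t, t ^ 2)] in at most two
    points, so some point of that curve avoids them all. *)
Lemma avoid_hyperplanes (vs : seq ('I_3 -> K)) :
  (forall v, List.In v vs -> exists a, v a != 0) ->
  exists mu : 'I_3 -> K, forall v, List.In v vs -> \sum_a mu a * v a != 0.
Proof.
pose P (v : 'I_3 -> K) : {poly K} := \poly_(n < 3) v (inord n).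
have Pt v t : (P v).[t] = \sum_(a < 3) t ^+ a * v a.
  rewrite horner_poly; apply: eq_bigr => a _.
  by rewrite inord_val mulrC.
move=> nz_vs.
have [t tP] : exists t, forall v, List.In v vs -> (P v).[t] != 0.
  have [|t] := @poly_nonroot (\prod_(v <- vs) P v).
    elim: vs nz_vs => [|v vs IH] nz_vs; first by rewrite big_nil oner_eq0.
    rewrite big_cons mulf_neq0 //; last first.
      by apply: IH => w w_in; apply: nz_vs; right.
    have [|a va] := nz_vs v; first by left.
    apply/eqP => /polyP/(_ a); rewrite coef_poly ltn_ord inord_val coef0.
    by apply/eqP.
  move=> nzt; exists t; elim: vs nzt {nz_vs} => [|v vs IH] // .
  rewrite big_cons hornerM mulf_eq0 negb_or => /andP[nzv nzvs] w /= [<- //|].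
  exact: IH.
by exists (fun a => t ^+ a) => v /tP; rewrite Pt.
Qed.

Lemma has_top_X_deriv n x h : has_top n x h -> has_top n (x *+ n) ('X * h^`()).
Proof.
move=> [szh <-]; split.
  have [->|nz] := eqVneq (h^`()) 0; first by rewrite mulr0 size_poly0.
  have nzh : h != 0 by apply: contraNneq nz => ->; rewrite deriv0.
  by rewrite mulrC size_mulX // (leq_trans (lt_size_deriv nzh)).
by rewrite coefXM; case: n {szh} => [|n] //=; rewrite coef_deriv.
Qed.

Definition wronskian f h := f * h^`() - h * f^`().

(** The factor ['X] makes [h |-> 'X * h^`()] preserve formal degrees. When [f] and
    [h] have the same formal degree the top coefficient below is zero, which
    bounds the degree of the Wronskian. *)
Lemma has_top_X_wronskian m n x y f h : has_top m x f -> has_top n y h ->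
  has_top (m + n) (x * (y *+ n) - y * (x *+ m)) ('X * wronskian f h).
Proof.
move=> tf th; rewrite /wronskian mulrBr [_ * (f * _)]mulrCA [_ * (h * _)]mulrCA.
rewrite -[- (y * _)]mulN1r -[- (h * _)]mulN1r; apply: has_topD.
  exact/has_topM/has_top_X_deriv.
rewrite -[(m + n)%N]add0n; apply: has_topM.
  by split; rewrite -?polyCN ?coefC // size_polyC_leq1.
by rewrite addnC; apply: has_topM => //; apply: has_top_X_deriv.
Qed.

(** The top coefficient of the Wronskian shows that [f] and [h] have the same
    degree, and so do [f] and [h - c f] for every [c] unless the latter vanishes;
    but some [c] lowers the degree. *)
Lemma wronskian_eq0 f h : f != 0 -> wronskian f h = 0 -> exists c, h = c *: f.
Proof.
have same_size (g : {poly K}) :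
    f != 0 -> g != 0 -> wronskian f g = 0 -> size g = size f.
  move=> nzf nzg w0.
  have top p : p != 0 -> has_top (size p).-1 (lead_coef p) p.
    by move=> nzp; split; rewrite // prednK ?size_poly_gt0.
  have [_] := has_top_X_wronskian (top _ nzf) (top _ nzg).
  rewrite w0 mulr0 coef0 => /esym/eqP.
  rewrite mulrnAr mulrnAr [lead_coef g * _]mulrC subr_eq0 => /eqP eqn.
  have /eqP : (size g).-1 = (size f).-1.
    apply/eqP; rewrite -(eqr_nat K); apply/eqP.
    apply: (@mulfI _ (lead_coef f * lead_coef g)).
      by rewrite mulf_neq0 // lead_coef_eq0.
    by rewrite !mulr_natr.
  by rewrite -eqSS !prednK ?size_poly_gt0 // => /eqP.
move=> nzf w0; have [->|nzh] := eqVneq h 0; first by exists 0; rewrite scale0r.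
pose c := lead_coef h / lead_coef f; exists c.
apply/eqP; rewrite -subr_eq0; apply/negPn/negP => nzg.
have wg : wronskian f (h - c *: f) = 0.
  rewrite -w0 /wronskian derivB derivZ -mul_polyC -[c *: _]mul_polyC; ring.
have := same_size _ nzf nzg wg; have sz := same_size _ nzf nzh w0.
move=> szg.
suff : (h - c *: f)`_(size f).-1 = 0.
  by rewrite -szg -/(lead_coef _) => /eqP; rewrite lead_coef_eq0 (negPf nzg).
rewrite coefB coefZ -{1}sz -!/(lead_coef _) /c divfK ?subrr //.
by rewrite lead_coef_eq0.
Qed.

Lemma meval_scale n k (c : K) (v : 'I_n -> K) (p : {mpoly K[n]}) :
  p \is k.-homog -> p.@[fun i => c * v i] = c ^+ k * p.@[v].
Proof. exact: mmap_dhomog_scale. Qed.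

Lemma ord3_addK (a : 'I_3) : a + 1 + 1 + 1 = a.
Proof. by apply/val_inj; case: a => [[|[|[|]]]]. Qed.

Lemma ord3_cases (a b : 'I_3) : [\/ b = a, b = a + 1 | b = a + 1 + 1].
Proof.
by case: a b => [[|[|[|//]]] ?] [[|[|[|//]]] ?];
  do ?[by apply: Or31; apply/val_inj | by apply: Or32; apply/val_inj
      | by apply: Or33; apply/val_inj].
Qed.

Lemma sum_ord3 (A : zmodType) (h : 'I_3 -> A) a :
  \sum_x h x = h a + h (a + 1) + h (a + 1 + 1).
Proof.
have h0 : \sum_x h x = h 0 + h 1 + h (1 + 1).
  rewrite !big_ord_recl big_ord0 addr0 addrA.
  by congr (h _ + h _ + h _); apply/val_inj.
rewrite h0; have [->|->|->] := ord3_cases 0 a; rewrite ?add0r //.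
  by rewrite -[1 + 1 + 1]add0r !addrA ord3_addK -addrA addrC.
by rewrite -[1 + 1 + 1]add0r !addrA ord3_addK add0r addrC addrA.
Qed.

Definition cross (p q : 'I_3 -> {poly K}) (a : 'I_3) : {poly K} :=
  p (a + 1) * q (a + 1 + 1) - p (a + 1 + 1) * q (a + 1).

(** Indices are taken modulo [3], so that by rotation only [b = a + 1] matters. *)
Lemma cross_proportional (f p q : 'I_3 -> {poly K}) a b :
  \sum_x f x * p x = 0 -> \sum_x f x * q x = 0 ->
  f a * cross p q b = f b * cross p q a.
Proof.
move=> fp fq.
have step c : f c * cross p q (c + 1) = f (c + 1) * cross p q c.
  rewrite /cross ord3_addK.
  transitivity (f (c + 1) * (p (c + 1) * q (c + 1 + 1) - p (c + 1 + 1) * q (c + 1))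
     + (p (c + 1 + 1) * \sum_x f x * q x - q (c + 1 + 1) * \sum_x f x * p x)).
    by rewrite !(sum_ord3 _ c); ring.
  by rewrite fp fq !mulr0 subr0 addr0.
have [->//|->|->] := ord3_cases a b; first exact: step.
by have := step (a + 1 + 1); rewrite ord3_addK => ->.
Qed.

Lemma cross_eq0 (p q : 'I_3 -> {poly K}) : (forall a, cross p q a = 0) ->
  forall a b, p a * q b = p b * q a.
Proof.
move=> pq0 a b.
have step c : p (c + 1) * q (c + 1 + 1) = p (c + 1 + 1) * q (c + 1).
  exact/subr0_eq/pq0.
have step' c : p c * q (c + 1) = p (c + 1) * q c.
  by have := step (c + 1 + 1); rewrite ord3_addK.
have [->//|->|->] := ord3_cases a b; first exact: step'.
by have := step' (a + 1 + 1); rewrite ord3_addK.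
Qed.

End Field.

(** * The gradient along a rational curve *)

Lemma complete_basis (K : fieldType) (u0 : 'rV[K]_2) : u0 != 0 ->
  exists2 u1 : 'rV[K]_2,
    (forall s t, s *: u0 + t *: u1 = 0 -> s = 0 /\ t = 0) &
    (forall u, exists s t, u = s *: u0 + t *: u1).
Proof.
move=> nz0.
have ordP (x : 'I_2) : x = 0 \/ x = 1.
  by case: x => [[|[|//]] ?]; [left | right]; apply/val_inj.
have [a [b [ab ne_ab nza]]] : exists a b : 'I_2,
    [/\ (forall x, x = a \/ x = b), a != b & u0 0 a != 0].
  have [e00|nz00] := eqVneq (u0 0 0) 0; last by exists 0, 1.
  exists 1, 0; split=> // [x|]; first by have [] := ordP x; auto.
  apply: contraNneq nz0 => e01; apply/eqP/rowP => x; rewrite mxE.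
  by have [->|->] := ordP x.
exists (delta_mx 0 b) => [s t st0|u].
  have /rowP/(_ a) := st0; rewrite !mxE eqxx (negPf ne_ab) mulr0 addr0 => /eqP.
  rewrite mulf_eq0 (negPf nza) orbF => /eqP s0; split=> //.
  have /rowP/(_ b) := st0; rewrite s0 scale0r add0r !mxE !eqxx.
  by rewrite mulr1.
exists (u 0 a / u0 0 a), (u 0 b - u 0 a / u0 0 a * u0 0 b).
apply/rowP => x; rewrite !mxE eqxx.
have [->|->] := ab x; first by rewrite (negPf ne_ab) mulr0 addr0 divfK.
by rewrite eqxx mulr1 addrC subrK.
Qed.

Section RationalCurve.
Variables (K : numClosedFieldType) (d m : nat).
Local Notation S := {mpoly K[3]}.
Variables (F : S) (phi : 'I_3 -> {mpoly K[2]}).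
Hypothesis d_gt0 : (0 < d)%N.
Hypothesis F_homog : F \is d.-homog.
Hypothesis F_irr : irreducible_elt F.
Hypothesis phi_morph : is_morphism m phi.
Hypothesis phi_nonconst : nonconstant phi.
Hypothesis phi_image : image_is_zero_locus phi F.

Let phi_homog a : phi a \is m.-homog.
Proof. by case: phi_morph. Qed.

Let phi_neq0 (u : 'rV[K]_2) : u != 0 -> exists a, (phi a).@[u 0] != 0.
Proof. by case: phi_morph => _; apply. Qed.

Lemma mor_val_neq0 (u : 'rV[K]_2) : u != 0 -> mor_val phi u != 0.
Proof.
move=> /phi_neq0[a]; apply: contraNneq => /rowP/(_ a).
by rewrite !mxE => ->.
Qed.

Lemma F_on_image (u : 'rV[K]_2) : u != 0 -> F.@[mor_val phi u 0] = 0.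
Proof.
move=> nzu; apply/(phi_image (mor_val_neq0 nzu)); exists u => //.
by exists 1; rewrite ?oner_eq0 // scale1r.
Qed.

Lemma mor_val_scale (c : K) (u : 'rV[K]_2) :
  mor_val phi (c *: u) = c ^+ m *: mor_val phi u.
Proof.
apply/rowP => a; rewrite !mxE -(meval_scale _ _ (phi_homog a)).
by apply: meval_eq => b; rewrite mxE.
Qed.

Section Basis.
Variables (u0 u1 : 'rV[K]_2).
Hypothesis indep : forall s t, s *: u0 + t *: u1 = 0 -> s = 0 /\ t = 0.
Hypothesis spanning : forall u, exists s t, u = s *: u0 + t *: u1.

(** The restriction of the parametrisation to the affine line through [u1]
    directed by [u0], whose point at infinity is [u0]. *)
Definition affine_param (a : 'I_3) : {poly K} :=
  mmap (@polyC K) (fun b : 'I_2 => u0 0 b *: 'X + (u1 0 b)%:P) (phi a).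
Local Notation psi := affine_param.
Local Notation ev := (mmap (@polyC K) psi).

Lemma line_neq0 t : t *: u0 + u1 != 0.
Proof.
apply/eqP => tu; have [] := indep (s := t) (t := 1).
  by rewrite scale1r.
by move=> _ /eqP; rewrite oner_eq0.
Qed.

Lemma psi_horner a t : (psi a).[t] = mor_val phi (t *: u0 + u1) 0 a.
Proof.
rewrite horner_mmap mxE; apply: meval_eq => b.
by rewrite hornerD hornerZ hornerX hornerC !mxE mulrC.
Qed.

Lemma psi_top a : has_top m (mor_val phi u0 0 a) (psi a).
Proof.
rewrite mxE -[X in has_top X]mul1n; apply: has_top_mmap (phi_homog a) => b.
split; last by rewrite coefD coefZ coefX coefC mulr1 addr0.
apply: leq_trans (size_polyD _ _) _; rewrite geq_max.
rewrite (leq_trans (size_scale_leq _ _)) ?size_polyX //=.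
by rewrite (leq_trans (size_polyC_leq1 _)).
Qed.

Lemma ev_horner p t : (ev p).[t] = p.@[mor_val phi (t *: u0 + u1) 0].
Proof. by rewrite horner_mmap; apply: meval_eq => a; rewrite psi_horner. Qed.

Lemma ev_top n p : p \is n.-homog ->
  has_top (m * n) p.@[mor_val phi u0 0] (ev p).
Proof. by apply: has_top_mmap => a; apply: psi_top. Qed.

Lemma point_cases (u : 'rV[K]_2) : u != 0 ->
  exists2 c, c != 0 & u = c *: u0 \/ exists t, u = c *: (t *: u0 + u1).
Proof.
move=> nzu; have [s [t uE]] := spanning u.
have [t0|nzt] := eqVneq t 0.
  exists s; last by left; rewrite uE t0 scale0r addr0.
  by apply: contraNneq nzu => s0; rewrite uE s0 t0 !scale0r addr0.
exists t => //; right; exists (s / t).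
by rewrite scalerDr scalerA mulrC divfK.
Qed.

Lemma ev_F : ev F = 0.
Proof.
apply: poly_eq0_values => t.
by rewrite ev_horner F_on_image // line_neq0.
Qed.

(** If all the [psi b] were multiples of one of them, [phi] would be constant also
    at the point at infinity [u0], whose image consists of top coefficients. *)
Lemma param_nonconst :
  exists a b, psi a != 0 /\ forall c, psi b != c *: psi a.
Proof.
have [a nza] := phi_neq0 (line_neq0 0).
have nzpsi : psi a != 0.
  by apply: contraNneq nza => a0; have := psi_horner a 0; rewrite a0 horner0 mxE => <-.
exists a; apply: contrapT => no_b.
have /choice[c cP] : forall b, exists c, psi b = c *: psi a.
  move=> b; apply: contrapT => no_c; apply: no_b; exists b; split=> // c.
  by apply/eqP => bE; apply: no_c; exists c.
have propE u : u != 0 -> exists2 l, l != 0 & mor_val phi u = l *: \row_b c b.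
  move=> nzu; have [l nzl lP] := point_cases nzu.
  have lm : l ^+ m != 0 by rewrite expf_neq0.
  have [x xE] : exists x, mor_val phi u = x *: \row_b c b.
    case: lP => [->|[t ->]]; rewrite mor_val_scale.
      exists (l ^+ m * mor_val phi u0 0 a); rewrite -scalerA; congr (_ *: _).
      apply/rowP => b; rewrite [RHS]mxE.
      have [_ <-] := psi_top b; have [_ <-] := psi_top a.
      by rewrite cP coefZ mulrC mxE.
    exists (l ^+ m * mor_val phi (t *: u0 + u1) 0 a); rewrite -scalerA.
    congr (_ *: _); apply/rowP => b; rewrite [RHS]mxE -!psi_horner.
    by rewrite cP hornerZ mulrC mxE.
  exists x => //; apply: contraNneq (mor_val_neq0 nzu) => x0.
  by rewrite xE x0 scale0r.
have [u [v [nzu nzv]]] := phi_nonconst; case.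
have [x nzx ->] := propE _ nzu; have [y nzy ->] := propE _ nzv.
exists (x / y); first by rewrite mulf_neq0 ?invr_eq0.
by rewrite scalerA divfK.
Qed.

(** A form of degree less than [d] that vanishes along the curve is a multiple of
    [F]. *)
Lemma form_eq0 n p : (n < d)%N -> p \is n.-homog -> ev p = 0 -> p = 0.
Proof.
have [a [b [nza nconst]]] := param_nonconst => lt_nd homp evp.
exact: (vanish_low_degree nza nconst F_irr F_homog ev_F lt_nd homp evp).
Qed.

Lemma deriv_homog a : F^`M(a) \is d.-1.-homog.
Proof. by apply: mderiv_dhomog; rewrite prednK. Qed.

Lemma deriv_nonzero : exists a, ev F^`M(a) != 0.
Proof.
apply: contrapT => no_a; have [nzF _ _] := F_irr; case/eqP: nzF.
have dF0 a : F^`M(a) = 0.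
  apply: form_eq0 (deriv_homog a) _; first by rewrite prednK.
  by apply/eqP/negPn/negP => nz; apply: no_a; exists a.
have := euler_dhomog F_homog; rewrite big1 => [|a _]; last by rewrite dF0 mulr0.
move/esym/eqP; rewrite -scaler_nat scaler_eq0 pnatr_eq0 eqn0Ngt d_gt0.
by move/eqP.
Qed.

Lemma gradient_orthogonal :
  \sum_a ev F^`M(a) * psi a = 0 /\ \sum_a ev F^`M(a) * (psi a)^`() = 0.
Proof.
split; last by rewrite -deriv_mmap ev_F derivC.
have := congr1 ev (euler_dhomog F_homog).
rewrite raddf_sum raddfMn /= ev_F mul0rn => eq0.
rewrite -[RHS]eq0; apply: eq_bigr => a _.
by rewrite rmorphM /= mmapX mmap1U mulrC.
Qed.

Local Notation w := (cross psi (fun b => (psi b)^`())).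

Lemma gradient_cross a b : ev F^`M(a) * w b = ev F^`M(b) * w a.
Proof. by case: gradient_orthogonal; apply: cross_proportional. Qed.

Lemma cross_neq0 a : ev F^`M(a) != 0 -> w a != 0.
Proof.
move=> nza; apply/negP => /eqP w0; have [i [j [nzi nconst]]] := param_nonconst.
have [||c jE] := @wronskian_eq0 _ (psi i) (psi j) => //; last first.
  by move: (nconst c); rewrite jE eqxx.
apply/eqP; rewrite subr_eq0; apply/eqP.
apply: (cross_eq0 (q := fun b => (psi b)^`())) => b.
by apply/eqP; move/eqP: (gradient_cross a b); rewrite w0 mulr0 mulf_eq0 (negPf nza).
Qed.

Lemma m_gt0 : (0 < m)%N.
Proof.
have [i [j [nzi nconst]]] := param_nonconst.
rewrite lt0n; apply/negP => /eqP m0.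
have psiC b : exists x, psi b = x%:P.
  by have [] := psi_top b; rewrite m0 => /size1_polyC; exists (psi b)`_0.
have [x xE] := psiC i; have [y yE] := psiC j.
have nzx : x != 0 by move: nzi; rewrite xE polyC_eq0.
by have := nconst (y / x); rewrite xE yE -mul_polyC -polyCM divfK ?eqxx.
Qed.

Lemma size_cross a : (size (w a) <= m.*2.-1)%N.
Proof.
have [->|nzw] := eqVneq (w a) 0; first by rewrite size_poly0.
have [szXw top0] := has_top_X_wronskian (psi_top (a + 1)) (psi_top (a + 1 + 1)).
have wE : wronskian (psi (a + 1)) (psi (a + 1 + 1)) = w a by [].
move: szXw top0; rewrite wE mulrnAr mulrnAr.
rewrite [_ * mor_val _ _ _ (a + 1)]mulrC subrr => szXw top0.
have szw : (size (w a) <= m + m)%N.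
  by rewrite -ltnS (leq_trans _ szXw) // mulrC size_mulX.
suff : size (w a) != (m + m)%N.
  by have := m_gt0; rewrite -addnn; move: (size (w a)) szw => x; lia.
apply: contraNneq nzw => szE; rewrite -lead_coef_eq0 lead_coefE szE.
by move: top0; rewrite coefXM ifF ?addn_eq0 ?eqn0Ngt ?m_gt0 // => ->.
Qed.

(** By [gradient_cross], multiplying [l ^+ n * p] by the cross product makes
    [F^`M(a)] a common factor along the parametrisation; it is prime to [l] and
    its degree [m (d - 1)] exceeds that of the remaining factor. The hypothesis
    at [u0] says that no zero of [F^`M(a)] lies at infinity. *)
Lemma saturation_bound (a : 'I_3) (l p : S) n r :
  F^`M(a).@[mor_val phi u0 0] != 0 ->
  (forall t, root (ev F^`M(a)) t -> (ev l).[t] != 0) ->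
  (r + 3 <= d)%N -> p \is r.-homog ->
  in_ideal (fun b => F^`M(b)) (l ^+ n * p) -> p = 0.
Proof.
move=> nz_inf coprime_l le_rd homp [c lpE].
have [szfa topfa] := ev_top (deriv_homog a).
have size_fa : size (ev F^`M(a)) = (m * d.-1).+1.
  apply/eqP; rewrite eqn_leq szfa ltnNge; apply/negP => lt_sz.
  by move: topfa; rewrite nth_default // => top0; rewrite -top0 eqxx in nz_inf.
have nzfa : ev F^`M(a) != 0 by rewrite -size_poly_eq0 size_fa.
have evlp : ev l ^+ n * ev p = \sum_b ev (c b) * ev F^`M(b).
  have := congr1 ev lpE; rewrite rmorphM rmorphXn /= => ->.
  have evD : {morph ev : x y / x + y} by move=> x y; rewrite rmorphD.
  rewrite (big_morph ev evD (rmorph0 ev)); apply: eq_bigr => b _.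
  by rewrite rmorphM.
have dvd_fa : ev F^`M(a) %| ev l ^+ n * (ev p * w a).
  have -> : ev l ^+ n * (ev p * w a) = ev F^`M(a) * \sum_b ev (c b) * w b.
    rewrite mulrA evlp mulr_suml mulr_sumr; apply: eq_bigr => b _.
    by rewrite -mulrA gradient_cross mulrCA.
  exact: dvdp_mulr.
have cop : coprimep (ev F^`M(a)) (ev l ^+ n).
  by apply/coprimep_expr/Pdiv.ClosedField.root_coprimep.
rewrite Gauss_dvdpr // in dvd_fa.
have lt_fa : (size (ev p * w a)%R < size (ev F^`M(a)))%N.
  rewrite size_fa; apply: leq_ltn_trans (size_polyMleq _ _) _.
  have [szp _] := ev_top homp; have := m_gt0; have := size_cross a.
  move: (size (w a)) (size (ev p)) szp => x y szp szx m_gt.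
  have : (m * r + m * 3 <= m * d)%N by rewrite -mulnDr leq_mul2l le_rd orbT.
  by case: (d) d_gt0 => // d' _ /=; rewrite mulnS; lia.
have /eqP : ev p * w a = 0.
  by apply/eqP; apply: contraTT dvd_fa => nz; rewrite gtNdvdp.
rewrite mulf_eq0 (negPf (cross_neq0 nzfa)) orbF => /eqP.
by apply: (form_eq0 (n := r)) => //; move: le_rd; lia.
Qed.

(** A common zero of the partial derivatives is on the curve by Euler's identity,
    so it is the image of a zero of [F^`M(a)], where [l] does not vanish. *)
Lemma no_singular_point_on_line (a : 'I_3) (l : S) (v : 'rV[K]_3) :
  l \is 1.-homog -> F^`M(a).@[mor_val phi u0 0] != 0 ->
  (forall t, root (ev F^`M(a)) t -> (ev l).[t] != 0) ->
  v != 0 -> l.@[v 0] = 0 -> exists b, F^`M(b).@[v 0] != 0.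
Proof.
move=> homl nz_inf coprime_l nzv lv0; apply: contrapT => no_b.
have Fb0 b : F^`M(b).@[v 0] = 0.
  by apply/eqP/negPn/negP => nz; apply: no_b; exists b.
have Fv0 : F.@[v 0] = 0.
  have := congr1 (meval (v 0)) (euler_dhomog F_homog).
  rewrite raddf_sum raddfMn /= big1 => [|b _]; last by rewrite mevalM Fb0 mulr0.
  by move/esym/eqP; rewrite -mulr_natr mulf_eq0 pnatr_eq0 eqn0Ngt d_gt0 orbF => /eqP.
have [u nzu [x nzx vE]] := (phi_image nzv).1 Fv0.
have [y nzy uE] := point_cases nzu.
have scaleE n (p : S) z : p \is n.-homog ->
    v = x *: (y ^+ m *: mor_val phi z) ->
    p.@[v 0] = (x * y ^+ m) ^+ n * p.@[mor_val phi z 0].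
  move=> homp ->; rewrite -(meval_scale _ _ homp); apply: meval_eq => b.
  by rewrite scalerA mxE.
have nzxy n : (x * y ^+ m) ^+ n != 0 by rewrite expf_neq0 // mulf_neq0 // expf_neq0.
case: uE vE => [->|[t ->]]; rewrite mor_val_scale => vE.
  have := Fb0 a; rewrite (scaleE _ _ _ (deriv_homog a) vE) => /eqP.
  by rewrite mulf_eq0 (negPf (nzxy _)) (negPf nz_inf).
have := coprime_l t; rewrite /root !ev_horner.
have /eqP := Fb0 a; rewrite (scaleE _ _ _ (deriv_homog a) vE) mulf_eq0.
rewrite (negPf (nzxy _)) /= => -> /(_ isT).
move/eqP: lv0; rewrite (scaleE _ _ _ homl vE) mulf_eq0 (negPf (nzxy _)) /= => ->.
by [].
Qed.

End Basis.
End RationalCurve.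

(** * The Milnor algebra of a rational curve *)

Section Choices.
Variable K : numClosedFieldType.
Local Notation S := {mpoly K[3]}.
Local Notation line := (lin 0 1 (1 + 1)).

Lemma meval_lin alpha beta (v : 'I_3 -> K) :
  (line alpha beta).@[v] = v (1 + 1) - (alpha * v 0 + beta * v 1).
Proof. by rewrite mevalB mevalD !mevalZ !mevalXU. Qed.

Lemma line_avoiding (vs : seq ('I_3 -> K)) :
  (forall v, List.In v vs -> exists a, v a != 0) ->
  exists alpha beta, forall v, List.In v vs -> (line alpha beta).@[v] != 0.
Proof.
move=> nz_vs.
(* Adding the last coordinate vector makes the coefficient of the last variable
   nonzero, so that the line has the required shape. *)
pose z (a : 'I_3) : K := (a == 1 + 1)%:R.
have [v [<-|/nz_vs //]|mu muP] := avoid_hyperplanes (vs := z :: vs).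
  by exists (1 + 1); rewrite /z eqxx oner_eq0.
have nz_mu : mu (1 + 1) != 0.
  have := muP z (or_introl erefl); rewrite (sum_ord3 _ 0) /z !add0r /= .
  by rewrite !mulr0 !add0r mulr1.
exists (- (mu 0 / mu (1 + 1))), (- (mu 1 / mu (1 + 1))) => v v_in.
have := muP v (or_intror v_in); apply: contraNneq => lv0.
rewrite (sum_ord3 _ 0) !add0r -[X in _ == X](mulr0 (mu (1 + 1))) -lv0 meval_lin.
by apply/eqP; field.
Qed.

(** The first form is one of the [f a] that does not vanish at the point at
    infinity of the line, so that its restriction has full degree. The second is
    a combination of the [f a] that vanishes at none of the zeros of the first on
    the line; it exists because the [f a] have no common zero there. *)
Lemma regular_pair alpha beta e (f : 'I_3 -> S) :
  (forall a, f a \is e.-homog) ->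
  (forall v : 'I_3 -> K, (exists a, v a != 0) -> (line alpha beta).@[v] = 0 ->
     exists a, (f a).@[v] != 0) ->
  exists (g : bool -> S) (c : {poly K}),
    [/\ forall b, g b \is e.-homog, forall b, in_ideal f (g b),
        size (res_line 0 1 alpha beta (g true)) = e.+1 &
        res_line 0 1 alpha beta (g true) %|
          c * res_line 0 1 alpha beta (g false) - 1].
Proof.
move=> homf nozero; set rho := res_line 0 1 alpha beta.
(* [vinf] is the point at infinity of the line. *)
pose vinf (a : 'I_3) : K := if a == 0 then 0 else if a == 1 then 1 else beta.
have [a nza] : exists a, (f a).@[vinf] != 0.
  apply: nozero; first by exists 1; rewrite /vinf /= oner_eq0.
  by rewrite meval_lin /vinf /= mulr0 mulr1 add0r subrr.
have [sza topa] := res_line_top 0 1 alpha beta (homf a).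
have size_a : size (rho (f a)) = e.+1.
  apply/eqP; rewrite eqn_leq sza ltnNge; apply/negP => lt_sz.
  by case/eqP: nza; rewrite -topa nth_default.
have [rs raE] := closed_field_poly_normal (rho (f a)).
pose pt (t : K) (b : 'I_3) : K :=
  if b == 0 then 1 else if b == 1 then t else alpha + beta * t.
have rho_pt p t : (rho p).[t] = p.@[pt t].
  rewrite horner_mmap; apply: meval_eq => b; rewrite /pt.
  by case: ifP => _; [|case: ifP => _]; rewrite ?hornerC ?hornerX // hornerD
    hornerZ hornerC hornerX.
have [w|mu muP] := avoid_hyperplanes (vs := [seq (fun b => (f b).@[pt t]) | t <- rs]).
  move=> /List.in_map_iff[t [<- _]].
  apply: nozero; first by exists 0; rewrite /pt /= oner_eq0.
  by rewrite meval_lin /pt /= mulr1 subrr.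
pose g (b : bool) : S := if b then f a else \sum_x mu x *: f x.
have rho_g t : (rho (g false)).[t] = \sum_x mu x * (f x).@[pt t].
  by rewrite rho_pt raddf_sum; apply: eq_bigr => x _; rewrite /= mevalZ.
have cop : coprimep (rho (f a)) (rho (g false)).
  apply: Pdiv.ClosedField.root_coprimep => t root_t; rewrite rho_g.
  apply: (muP (fun b => (f b).@[pt t])); apply/List.in_map_iff; exists t; split=> //.
  have nz_lc : lead_coef (rho (f a)) != 0.
    by rewrite lead_coef_eq0 -size_poly_eq0 size_a.
  move: root_t; rewrite raE rootZ // root_prod_XsubC.
  elim: (rs) => // r s IH; rewrite inE => /orP[/eqP->|/IH]; first by left.
  by right.
have /Bezout_eq1_coprimepP[[x y] xy1] := cop.
exists g, y; split=> //; first last.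
- by rewrite -xy1 opprD addrCA subrr addr0 -mulNr dvdp_mull.
- case; first exact: in_ideal_gen.
  by apply: in_ideal_sum => b; rewrite -mul_mpolyC; apply/in_idealM/in_ideal_gen.
- by case=> //=; rewrite /g; apply: rpred_sum => b _; apply/rpredZ/homf.
Qed.

End Choices.

Section MilnorDimension.

(** The hypotheses say that [h] induces an isomorphism from [V / U] to
    [V' / U']. *)
Lemma dim_compl_eq (K : fieldType) (V V' : vectType K) (h : 'Hom(V, V'))
    (U : {vspace V}) (U' : {vspace V'}) :
  (forall v, h v \in U' -> v \in U) -> (forall v, v \in U -> h v \in U') ->
  (forall v', exists v, v' - h v \in U') ->
  \dim U^C = \dim U'^C.
Proof.
move=> inj stable surj.
have directC : (U :&: U^C = 0)%VS by apply: capv_compl.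
have ker0 : (U^C :&: lker h = 0)%VS.
  apply/eqP; rewrite -subv0 -directC subv_cap capvSl andbT.
  apply/subvP => v /memv_capP[_]; rewrite memv_ker => /eqP hv0.
  by apply: inj; rewrite hv0 mem0v.
have dim_h : \dim (h @: U^C) = \dim U^C by apply: limg_dim_eq.
have cap0 : (h @: U^C :&: U' = 0)%VS.
  apply/eqP; rewrite -subv0; apply/subvP => w /memv_capP[/memv_imgP[v vC ->] hvU].
  have : v \in (U :&: U^C)%VS by rewrite memv_cap inj.
  by rewrite directC memv0 => /eqP->; rewrite linear0 mem0v.
have sumT : (h @: U^C + U' = fullv)%VS.
  apply/eqP; rewrite eqEsubv subvf; apply/subvP => w _.
  have [v vP] := surj w; have : v \in (U + U^C)%VS by rewrite addv_complf memvf.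
  case/memv_addP => x xU [y yC vE].
  apply/memv_addP; exists (h y); first exact: memv_img.
  exists (w - h v + h x); first by rewrite rpredD // stable.
  have -> : w - h v + h x = w - h y.
    by rewrite vE linearD /= opprD addrA addrAC subrK.
  by rewrite addrC subrK.
have := dimv_disjoint_sum cap0; rewrite sumT dim_h => dimT.
by rewrite [RHS]dimv_compl dimT addnK.
Qed.

End MilnorDimension.

Section Threshold.
Variables (K : fieldType) (F : {mpoly K[3]}).

Lemma threshold_le s :
  (forall q, (s <= q)%N -> milnor_dim F q = milnor_dim F q.+1) ->
  exists2 st, is_stability_threshold F st & (st <= s)%N.
Proof.
move=> stable; pose tau := milnor_dim F s.
have from_s : milnor_dim_from F tau s.
  move=> q /subnKC <-; elim: (q - s)%N => [|n IH]; first by rewrite addn0.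
  by rewrite addnS -stable ?leq_addr.
have ex_st : exists st, `[< milnor_dim_from F tau st >].
  by exists s; apply/asboolP.
case: (ex_minnP ex_st) => st /asboolP from_st min_st; exists st.
  exists tau; first by exists s.
  by split=> // q from_q; apply/min_st/asboolP.
by apply/min_st/asboolP.
Qed.

Definition mul_form (l : {mpoly K[3]}) (homl : l \is 1.-homog) q
    (p : dhomog 3 K q) : dhomog 3 K q.+1 :=
  DHomog (dhomogM homl (dhomog_is_dhomog p)).

Lemma mul_form_is_linear l homl q : linear (@mul_form l homl q).
Proof. by move=> a p r; apply/val_inj; rewrite /= mulrDr scalerAr. Qed.

HB.instance Definition _ l homl q :=
  GRing.isLinear.Build K (dhomog 3 K q) (dhomog 3 K q.+1) _
    (@mul_form l homl q) (@mul_form_is_linear l homl q).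

Lemma milnor_dim_succ (l : {mpoly K[3]}) q : l \is 1.-homog ->
  (forall p, p \is q.-homog -> jacobian_ideal F (l * p) -> jacobian_ideal F p) ->
  (forall p, p \is q.+1.-homog -> exists2 r, r \is q.-homog &
     jacobian_ideal F (p - l * r)) ->
  milnor_dim F q = milnor_dim F q.+1.
Proof.
move=> homl inj surj.
apply: (dim_compl_eq (h := linfun (@mul_form l homl q))) => [p|p|p].
- rewrite lfunE /= => /mem_jacobian_part /= ilp.
  apply/mem_jacobian_part; apply: inj ilp; exact: dhomog_is_dhomog.
- move/mem_jacobian_part => ip; rewrite lfunE; apply/mem_jacobian_part.
  exact: (@in_idealM _ _ (fun a => F^`M(a)) l _ ip).
- have [r homr ir] := surj _ (dhomog_is_dhomog p).
  by exists (DHomog homr); apply/mem_jacobian_part; rewrite lfunE.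
Qed.

Lemma saturation_linX (l p : {mpoly K[3]}) : l \is 1.-homog ->
  saturation (jacobian_ideal F) p -> exists n, jacobian_ideal F (l ^+ n * p).
Proof.
move=> homl [n satp]; exists n.
have : l ^+ n \is n.-homog by rewrite -[X in X.-homog]mul1n dhomogMn.
move: (l ^+ n); pose I := in_ideal (fun a => F^`M(a)).
apply: (dhomog_ind (P := fun r => I (r * p))) => [|c m /satp ip|r s ir is_].
- by rewrite mul0r; apply: in_ideal0.
- by rewrite -mul_mpolyC -mulrA; apply: in_idealM.
- by rewrite mulrDl; apply: in_idealD.
Qed.

End Threshold.

Theorem rational_curve_milnor (K : numClosedFieldType) (d : nat)
    (F : {mpoly K[3]}) : (3 <= d)%N -> rational_plane_curve d F ->
  (forall k : int, k <= d%:Z - 3%:Z -> N_vanishes F k) /\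
  (exists2 st : nat, is_stability_threshold F st & (st <= 2 * d - 3)%N).
Proof.
move=> le3d [homF irrF [m [phi [morph nonc img]]]].
have d_gt0 : (0 < d)%N by lia.
(* The point at infinity [u0] of the affine line is moved to a place where some
   partial derivative does not vanish. *)
pose e1 : 'rV[K]_2 := delta_mx 0 0.
have nz_e1 : e1 != 0.
  by apply/eqP => /rowP/(_ 0)/eqP; rewrite !mxE !eqxx oner_eq0.
have [e2 ind12 span12] := complete_basis nz_e1.
have [a] := deriv_nonzero d_gt0 homF irrF morph nonc img ind12 span12.
case/poly_nonroot => t; rewrite ev_horner // => nz_a.
have [u1 ind span] := complete_basis (line_neq0 ind12 t).
set u0 := t *: e1 + e2 in nz_a ind span.
pose psi := affine_param phi u0 u1.
pose ev := mmap (@polyC K) psi.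
(* The line avoids the images of the zeros of this partial derivative. *)
have [rs rsE] := closed_field_poly_normal (ev F^`M(a)).
pose pt (s : K) (b : 'I_3) := mor_val phi (s *: u0 + u1) 0 b.
have [w|alpha [beta lP]] := line_avoiding (vs := [seq pt s | s <- rs]).
  move=> /List.in_map_iff[s [<- _]].
  have /rV0Pn[b nzb] := mor_val_neq0 morph (line_neq0 ind s).
  by exists b.
set l := lin _ _ _ alpha beta in lP.
have homl : l \is 1.-homog by apply: lin_homog.
have nz_fa : ev F^`M(a) != 0.
  have [_ top] := ev_top morph u0 u1 (deriv_homog d_gt0 homF a).
  by apply: contraNneq nz_a => fa0; rewrite -top -[mmap _ _ _]/(ev F^`M(a)) fa0 coef0.
have coprime_l s : root (ev F^`M(a)) s -> (ev l).[s] != 0.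
  rewrite rsE rootZ ?lead_coef_eq0 // root_prod_XsubC => s_in.
  rewrite ev_horner //; apply: lP; apply/List.in_map_iff; exists s; split=> //.
  elim: (rs) s_in => // r rs' IH; rewrite inE => /orP[/eqP->|/IH]; first by left.
  by right.
have saturation0 n r p : (r + 3 <= d)%N -> p \is r.-homog ->
    jacobian_ideal F (l ^+ n * p) -> p = 0.
  exact: (saturation_bound d_gt0 homF irrF morph nonc img ind span nz_a coprime_l).
split=> [k le_k p homp satp|].
  have [n ip] := saturation_linX homl satp.
  suff -> : p = 0 by exact: (in_ideal0 (fun b => F^`M(b))).
  case: k le_k homp => [k|k] le_k //= homp.
  by apply: saturation0 homp ip; clear -le_k; lia.
apply: threshold_le => q le_q.
pose e := d.-1; have homf b : F^`M(b) \is e.-homog by apply: deriv_homog.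
have [v nzv lv0|g [c [homg g_in_f size_g1 c_inv]]] :=
  regular_pair (alpha := alpha) (beta := beta) homf.
  have nz_row : \row_b v b != 0 by apply/rV0Pn; case: nzv => b; exists b; rewrite mxE.
  have := no_singular_point_on_line d_gt0 homF morph img span homl nz_a coprime_l
    nz_row.
  have rowE (p : {mpoly K[3]}) : p.@[(\row_b v b) 0] = p.@[v].
    by apply: meval_eq => b; rewrite mxE.
  by rewrite rowE => /(_ lv0)[b]; rewrite rowE; exists b.
have e_gt0 : (0 < e)%N by clear -le3d; lia.
have low n r p : (r.+2 <= e)%N -> p \is r.-homog ->
    in_ideal (fun b => F^`M(b)) (l ^+ n * p) -> p = 0.
  by move=> le_r; apply: saturation0; clear -le_r; lia.
have le_eq : (e.*2.-1 <= q)%N by clear -le_q; lia.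
have n01 : (1 : 'I_3) != 0 by []. have n02 : (1 + 1 : 'I_3) != 0 by [].
have n12 : (1 + 1 : 'I_3) != 1 by [].
apply: (milnor_dim_succ homl) => p homp.
  exact: (lin_injective n01 n02 n12 e_gt0 homf homg g_in_f size_g1 c_inv low
            le_eq homp).
have [r homr ir] := lin_surjective n01 n02 n12 homg g_in_f size_g1 c_inv
  (leqW le_eq) homp.
by exists r.
Qed.

Theorem theorem2p11 (R : realType) (d : nat) (F : {mpoly R[i][3]}) :
  (3 <= d)%N ->
  rational_plane_curve d F ->
  (forall k : int, k <= d%:Z - 3%:Z -> N_vanishes F k) /\
  (exists2 st : nat, is_stability_threshold F st & (st <= 2 * d - 3)%N).
Proof. exact: rational_curve_milnor. Qed.
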